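(* Let $N\ge1$. Fix $\Theta^0=(\theta_i^0)$, $\Omega^0=(\omega_i^0)$, $\mathcal V=(\nu_i)\in\mathbb{R}^N$ and $\kappa>0$. For each $m>0$ let $\Theta(m,t)$, $t\ge0$, be the solution of the inertial Kuramoto Cauchy problem, and let $\Theta(0,t)$, $t\ge0$, be the solution of the first-order Kuramoto Cauchy problem (see context). Then the following hold for all $m>0$. (1) $\Theta(m,\cdot)\to\Theta(0,\cdot)$ as $m\to0^+$ in the Fréchet topology of $C^0([0,\infty))$, and for all $t\ge0$, $$\|\Theta(m,t)-\Theta(0,t)\|_\infty< m\left|\frac{\max_i(\omega_i^0-\nu_i)+\min_i(\omega_i^0-\nu_i)}{2}\right|+\frac12m\left(\mathcal D(\Omega^0-\mathcal V)+2\kappa\right)e^{2\kappa t},$$ $$\mathcal D(\Theta(m,t)-\Theta(0,t))<m\left(\mathcal D(\Omega^0-\mathcal V)+2\kappa\right)e^{2\kappa t}.$$ (2) $\dot\Theta(m,\cdot)\to\dot\Theta(0,\cdot)$ as $m\to0^+$ in the Fréchet topology of $C^0(0,\infty)$, and for all $t\ge0$, $$\|\dot\Theta(m,t)-\dot\Theta(0,t)\|_\infty<\left(\|\Omega^0-\mathcal V\|_\infty+\kappa\right)e^{-t/m}+m\kappa(\mathcal D(\mathcal V)+2\kappa)+m\kappa\left(\mathcal D(\Omega^0-\mathcal V)+2\kappa\right)e^{2\kappa t},$$ $$\mathcal D(\dot\Theta(m,t)-\dot\Theta(0,t))<\left(\mathcal D(\Omega^0-\mathcal V)+2\kappa\right)e^{-t/m}+2m\kappa(\mathcal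 D(\mathcal V)+2\kappa)+2m\kappa\left(\mathcal D(\Omega^0-\mathcal V)+2\kappa\right)e^{2\kappa t}.$$ (3) $\Theta(m,\cdot)\to\Theta(0,\cdot)$ as $m\to0^+$ in the Fréchet topology of $C^\infty(0,\infty)$, and for every integer $n\ge2$ and all $t\ge0$, $$\begin{aligned}\|\Theta^{(n)}(m,t)-\Theta^{(n)}(0,t)\|_\infty\le{}&(n-1)!\left(2\kappa+\|\Omega^0\|_\infty+\|\mathcal V\|_\infty+\frac{9}{8m}\right)^n\left(1+\frac tm\right)^ne^{-t/m}\\&+\frac98m\kappa\, n!\,e^{2\kappa t}\left(2\kappa+\mathcal D(\Omega^0)+\mathcal D(\mathcal V)+\frac9{8m}\right)^n\left(1+\frac tm\right)^ne^{-t/m}\\&+\frac34m\kappa\,(n+1)!\,e^{2\kappa t}\left(2\kappa+\mathcal D(\Omega^0)+\mathcal D(\mathcal V)\right)^n(1-e^{-t/m}),\end{aligned}$$ $$\begin{aligned}\mathcal D(\Theta^{(n)}(m,t)-\Theta^{(n)}(0,t))\le{}&2(n-1)!\left(2\kappa+\mathcal D(\Omega^0)+\mathcal D(\mathcal V)+\frac9{8m}\right)^n\left(1+\frac tm\right)^ne^{-t/m}\\&+\frac32(n+1)!\,m\kappa e^{2\kappa t}\left(2\kappa+\mathcal D(\Omega^0)+\mathcal D(\mathcal V)+\frac9{8m}\right)^n\left(1+\frac tm\right)^ne^{-t/m}\\&+\frac32(n+1)!\,m\kappa e^{2\kappa t}\left(2\kappa+\mathcal D(\Omega^0)+\mathcal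 D(\mathcal V)\right)^n(1-e^{-t/m}).\end{aligned}$$
   Context: The inertial Kuramoto Cauchy problem with inertia $m>0$ is $$m\ddot\theta_i+\dot\theta_i=\nu_i+\frac{\kappa}{N}\sum_{j=1}^N\sin(\theta_j-\theta_i),\quad \theta_i(0)=\theta_i^0,\ \dot\theta_i(0)=\omega_i^0,\quad i=1,\dots,N.$$ The first-order Kuramoto Cauchy problem is $$\dot\theta_i=\nu_i+\frac{\kappa}{N}\sum_{j=1}^N\sin(\theta_j-\theta_i),\quad \theta_i(0)=\theta_i^0,\quad i=1,\dots,N.$$ Both have unique global real-analytic solutions. For $X=(x_1,\dots,x_N)\in\mathbb{R}^N$: $\|X\|_\infty=\max_i|x_i|$ and $\mathcal D(X)=\max_{i,j}|x_i-x_j|$. Dots and superscripts $(n)$ denote derivatives in $t$. Convergence in the Fréchet topology of $C^0([0,\infty))$ (resp. $C^0(0,\infty)$) means uniform convergence on compact subintervals of $[0,\infty)$ (resp. of $(0,\infty)$); convergence in the Fréchet topology of $C^\infty(0,\infty)$ means that the functions and all their $t$-derivatives converge uniformly on compact subintervals of $(0,\infty)$. *)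

(* Defs.v *)
From Stdlib Require Import Reals RList Lra.
From mathcomp Require Import all_boot.
From Coquelicot Require Import Coquelicot.

Set Implicit Arguments.
Unset Strict Implicit.
Unset Printing Implicit Defensive.

Local Open Scope R_scope.

(* [MaxRlist] and [MinRlist] have junk values on the empty list, so [vmax] and
   [vmin] are meaningful for [0 < N] only. *)
Definition vmax (N : nat) (X : 'I_N -> R) : R := MaxRlist (map X (enum 'I_N)).

Definition vmin (N : nat) (X : 'I_N -> R) : R := MinRlist (map X (enum 'I_N)).

Definition norm_inf (N : nat) (X : 'I_N -> R) : R := vmax (fun i => Rabs (X i)).

Definition diam (N : nat) (X : 'I_N -> R) : R :=
  vmax (fun i => vmax (fun j => Rabs (X i - X j))).

(* A function on [0, +oo) is represented by a total function whose values at
   negative arguments are irrelevant. Hence derivatives are taken relative to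
   [0, +oo): one-sided at 0, and the usual ones at positive times. *)
Definition half_line (t : R) : Prop := 0 <= t.

Definition is_derive_half (f : R -> R) (t l : R) : Prop :=
  filterdiff f (within half_line (locally t)) (fun y => scal y l).

Definition ex_derive_half (f : R -> R) (t : R) : Prop :=
  exists l, is_derive_half f t l.

Definition Derive_half (f : R -> R) (t : R) : R := iota (is_derive_half f t).

Definition Derive_half_n (n : nat) (f : R -> R) : R -> R := iter n Derive_half f.

Lemma is_derive_half_unique (f : R -> R) (t l : R) :
  0 <= t -> is_derive_half f t l -> Derive_half f t = l.
Proof.
move=> t0 Hl; apply: iota_unique => // k Hk.
have Ft : is_filter_lim (within half_line (locally t)) t.
  by move=> P HP; apply: filter_le_within.
case: (Req_dec k l) => // kl; exfalso.
have e0 : 0 < Rabs (k - l) / 4 by have := Rabs_pos_lt (k - l); lra.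
have [d Hd] := filter_and _ _ (proj2 Hk _ Ft (mkposreal _ e0))
                              (proj2 Hl _ Ft (mkposreal _ e0)).
have d0 := cond_pos d.
have Hb : ball t d (t + d / 2).
  by rewrite /ball /= /AbsRing_ball /abs /minus /plus /opp /=; apply: Rabs_def1; lra.
have Hh : half_line (t + d / 2) by rewrite /half_line; lra.
have := Hd _ Hb Hh.
rewrite /norm /= /abs /minus /plus /opp /scal /= /mult /=.
have -> : t + d / 2 + - t = d / 2 by lra.
rewrite (Rabs_pos_eq (d / 2)); last lra.
set a := f (t + d / 2) + - f t; case=> Ha Hb'.
have : Rabs (d / 2 * (k - l)) <= Rabs (a + - (d / 2 * k)) + Rabs (a + - (d / 2 * l)).
  rewrite -(Rabs_Ropp (a + - (d / 2 * k))).
  apply: Rle_trans (Rabs_triang _ _).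
  by apply: Req_le; congr Rabs; ring.
rewrite Rabs_mult (Rabs_pos_eq (d / 2)); last lra.
have := Rmult_lt_0_compat _ _ d0 e0; lra.
Qed.

Lemma is_derive_half_pos (f : R -> R) (t l : R) :
  0 < t -> is_derive_half f t l <-> is_derive f t l.
Proof.
move=> t0.
have E P : within half_line (locally t) P <-> locally t P.
  split; last exact: filter_le_within.
  move=> H; have : locally t (fun s => 0 < s) by exact: open_gt.
  by move: H; rewrite /within => H /(filter_and _ _ H); apply: filter_imp => s [Hs Hp];
     apply: Hs; apply: Rlt_le.
split; move=> [Hlin H]; split=> // x Hx eps.
  by apply/E; apply: H => P /Hx; apply E.
by apply/E; apply: H => P /Hx; apply E.
Qed.

Definition coupling (N : nat) (kappa : R) (X : 'I_N -> R) (i : 'I_N) : R :=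
  kappa / INR N * \big[Rplus/0]_(j < N) sin (X j - X i).

Definition first_order_kuramoto (N : nat) (kappa : R)
    (nu theta0 : 'I_N -> R) (theta : 'I_N -> R -> R) : Prop :=
  (forall i, theta i 0 = theta0 i) /\
  (forall i t, 0 <= t ->
     ex_derive_half (theta i) t /\
     Derive_half (theta i) t = nu i + coupling kappa (theta^~ t) i).

Definition inertial_kuramoto (N : nat) (m kappa : R)
    (nu theta0 omega0 : 'I_N -> R) (theta : 'I_N -> R -> R) : Prop :=
  (forall i, theta i 0 = theta0 i) /\
  (forall i, Derive_half (theta i) 0 = omega0 i) /\
  (forall i t, 0 <= t ->
     ex_derive_half (theta i) t /\
     ex_derive_half (Derive_half (theta i)) t /\
     m * Derive_half_n 2 (theta i) t + Derive_half (theta i) t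
       = nu i + coupling kappa (theta^~ t) i).

(* The limit [F m --> f] as [m --> 0+] in [C^0(I)], including membership of all
   functions in that space. *)
Definition cvg_C0 (N : nat) (I : R -> Prop)
    (F : R -> 'I_N -> R -> R) (f : 'I_N -> R -> R) : Prop :=
  (forall m i, 0 < m -> continuous_on I (F m i)) /\
  (forall i, continuous_on I (f i)) /\
  (forall a b, a <= b -> (forall t, a <= t <= b -> I t) ->
     forall eps : posreal, at_right 0 (fun m =>
       forall t, a <= t <= b -> norm_inf (fun i => F m i t - f i t) < eps)).

(* The same in C^infty on the open half-line, for all time derivatives. *)
Definition cvg_Cinfty (N : nat)
    (F : R -> 'I_N -> R -> R) (f : 'I_N -> R -> R) : Prop :=
  (forall n m i t, 0 < m -> 0 < t -> ex_derive_half (Derive_half_n n (F m i)) t) /\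
  (forall n i t, 0 < t -> ex_derive_half (Derive_half_n n (f i)) t) /\
  (forall n, cvg_C0 (Rlt 0) (fun m i => Derive_half_n n (F m i))
                            (fun i => Derive_half_n n (f i))).

(* Main.v *)
Require Import Defs.
From Stdlib Require Import Reals RList Lra.
From HB Require Import structures.
From mathcomp Require Import all_boot.
From Coquelicot Require Import Coquelicot.

(** The coupling sees phase differences only. Estimates on pairs of indices therefore close among
    themselves, with [2 * kappa] as the cost of a pair and diameters as the only data. A bound on a
    single phase then needs no induction of its own: the pair bounds already control its forcing,
    and one more relaxation argument, with [kappa] in place of [2 * kappa], finishes. This is why
    diameters persist in the estimates of the maximum norm and why their limit constant is half of
    the one for diameters. Solving the inertial equation at time 0 for the highest derivative
    divides by m at each order, so the initial derivative of order n is of size m^(1-n); this forces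
    a multiple of 1/m into the layer ratio. The limit part is small because the first-order solution
    violates the inertial equation only by m times its second derivative, which is of size m kappa.
    The relaxation lemma wants a constant b, so the growth factor exp(2 kappa s) is frozen at the
    final time t. A layer term is a polynomial in 1/m times exp(-t/m), hence O(m) uniformly on t >=
    a for each a > 0, but not up to t = 0: derivatives converge on the open half-line only. *)

(* Write tau = t/m and let delta be the difference of the two solutions.
   Differentiating the two equations n times shows that every derivative y of
   theta_m and of delta satisfies a relaxation equation m y' + y = g. If
   |g(s)| <= k a (1 + s/m)^(k-1) e^(-s/m) + b and |y(0)| <= a, then
   |y(t)| <= a (1 + tau)^k e^(-tau) + b (1 - e^(-tau)): the bound is a convex
   combination, with weights e^(-tau) and 1 - e^(-tau), of an initial-layer part
   and a limit part. All bounds have this shape, with initial layer part of the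
   form g_k x^k, x = Q (1 + tau), and limit part h_k B^k, where B <= x and
   h_k <= g_k. By Chebyshev's inequality the product of two such combinations is
   at most the combination of the products, so Leibniz' rule can be applied to
   both parts separately, as for power series: if |phi^(k)| <= (k-1)! x^k then
   |sin(phi)^(k)| <= k! x^k since exp(- ln(1 - x u)) = 1/(1 - x u); and if moreover
   the difference of two phases has k-th derivative at most k! g_k x^k, then that
   of their sines is at most k! (g_0 + ... + g_k) x^k. The theorem thus reduces to
   numerical inequalities on the sequences g and h. For n = 2 the crude bound
   2 B^2 on (sin phi)'' is slightly too large, and (3/2) B^2, from the
   Cauchy-Schwarz inequality, is needed. *)

Set Implicit Arguments.
Unset Strict Implicit.
Unset Printing Implicit Defensive.

Local Open Scope R_scope.
Local Arguments INR : simpl never.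

(** * Calculus on the half-line *)

Ltac nonneg := repeat first [assumption | lra | apply: pos_INR | apply: pow_le | apply: Rmult_le_pos].

Lemma half_line_lim (t x : R) :
  0 <= t -> is_filter_lim (within half_line (locally t)) x -> x = t.
Proof.
move=> t0 Hx; case: (Req_dec x t) => // xt; exfalso.
have d0 : 0 < Rabs (x - t) / 2 by have := Rabs_pos_lt (x - t); lra.
have Hd : locally x (fun y => Rabs (y - x) < Rabs (x - t) / 2).
  by exists (mkposreal _ d0).
have [e He] := Hx _ Hd.
have := He t (ball_center _ _) t0.
rewrite Rabs_minus_sym; lra.
Qed.

(* Every differentiation rule on the half-line follows from the two-sided one
   through an extension to a neighbourhood of the base point. *)
Lemma half_deriveP (f : R -> R) (t l : R) : 0 <= t ->
  is_derive_half f t l <->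
  exists F, is_derive F t l /\ forall s, 0 <= s -> F s = f s.
Proof.
move=> t0; split.
- move=> [Hlin H].
  (* At negative arguments the extension follows the tangent line at [t], so its remainder vanishes
     there. *)
  exists (fun s => if Rle_dec 0 s then f s else f t + scal (s - t) l); split; last first.
    by move=> s s0; case: Rle_dec.
  split=> // x Hx.
  have Ex := is_filter_lim_locally_unique _ _ Hx; rewrite -Ex.
  have Ft : is_filter_lim (within half_line (locally t)) t.
    by move=> P HP; apply: filter_le_within.
  move=> eps; move: (H t Ft eps); rewrite /within; apply: filter_imp => s Hs.
  case: (Rle_dec 0 t) => [t0' | /(_ t0)] //=.
  case: (Rle_dec 0 s) => [/Hs // | s0] /=.
  have -> : minus (minus (f t + scal (s - t) l) (f t)) (scal (minus s t) l) = 0.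
    by rewrite /minus /plus /opp /scal /= /mult /=; ring.
  rewrite -[norm 0]/(Rabs 0) Rabs_R0.
  by apply: Rmult_le_pos; [apply: Rlt_le (cond_pos _) | apply: norm_ge_0].
- move=> [F [[Hlin H] EF]]; split=> // x Hx eps.
  have Ex := half_line_lim t0 Hx; rewrite Ex.
  have Ft : is_filter_lim (locally t) t by [].
  move: (H t Ft eps); rewrite /within; apply: filter_imp => s Hs s0.
  by rewrite -!EF.
Qed.

Lemma is_derive_half_ext (f g : R -> R) (t l : R) : 0 <= t ->
  (forall s, 0 <= s -> f s = g s) -> is_derive_half f t l -> is_derive_half g t l.
Proof.
move=> t0 E /(half_deriveP _ _ t0) [F [HF EF]].
by apply/(half_deriveP _ _ t0); exists F; split=> // s s0; rewrite EF ?E.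
Qed.

Lemma is_derive_is_derive_half (f : R -> R) (t l : R) : 0 <= t ->
  is_derive f t l -> is_derive_half f t l.
Proof. by move=> t0 H; apply/(half_deriveP _ _ t0); exists f. Qed.

Lemma is_derive_half_plus (f g : R -> R) (t a b : R) : 0 <= t ->
  is_derive_half f t a -> is_derive_half g t b ->
  is_derive_half (fun s => f s + g s) t (a + b).
Proof.
move=> t0 /(half_deriveP _ _ t0) [F [HF EF]] /(half_deriveP _ _ t0) [G [HG EG]].
apply/(half_deriveP _ _ t0); exists (fun s => F s + G s); split.
  exact: is_derive_plus.
by move=> s s0; rewrite EF ?EG.
Qed.

Lemma is_derive_half_scal (f : R -> R) (c t a : R) : 0 <= t ->
  is_derive_half f t a -> is_derive_half (fun s => c * f s) t (c * a).
Proof.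
move=> t0 /(half_deriveP _ _ t0) [F [HF EF]].
apply/(half_deriveP _ _ t0); exists (fun s => c * F s); split.
  exact: is_derive_scal.
by move=> s s0; rewrite EF.
Qed.

Lemma is_derive_half_minus (f g : R -> R) (t a b : R) : 0 <= t ->
  is_derive_half f t a -> is_derive_half g t b ->
  is_derive_half (fun s => f s - g s) t (a - b).
Proof.
move=> t0 Hf Hg; apply: (is_derive_half_ext (f := fun s => f s + (-1) * g s)) => //.
  by move=> s _; ring.
have -> : a - b = a + (-1) * b by ring.
by apply: is_derive_half_plus => //; exact: is_derive_half_scal.
Qed.

Lemma is_derive_half_mult (f g : R -> R) (t a b : R) : 0 <= t ->
  is_derive_half f t a -> is_derive_half g t b ->
  is_derive_half (fun s => f s * g s) t (a * g t + f t * b).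
Proof.
move=> t0 /(half_deriveP _ _ t0) [F [HF EF]] /(half_deriveP _ _ t0) [G [HG EG]].
apply/(half_deriveP _ _ t0); exists (fun s => F s * G s); split.
  by rewrite -(EF t) // -(EG t) //; apply: (is_derive_mult F G) => // x y; apply: Rmult_comm.
by move=> s s0; rewrite EF ?EG.
Qed.

Lemma is_derive_half_comp (h f : R -> R) (t a b : R) : 0 <= t ->
  is_derive h (f t) b -> is_derive_half f t a ->
  is_derive_half (fun s => h (f s)) t (b * a).
Proof.
move=> t0 Hh /(half_deriveP _ _ t0) [F [HF EF]].
apply/(half_deriveP _ _ t0); exists (fun s => h (F s)); split.
  by rewrite Rmult_comm; apply: is_derive_comp => //; rewrite EF.
by move=> s s0; rewrite EF.
Qed.

(** Precomposing with [Rmax 0] turns the one-sided continuity at 0 into a two-sided one, the form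
    that the mean value and extreme value theorems ask for. *)
Lemma is_derive_half_continuous (f : R -> R) (t l : R) : 0 <= t ->
  is_derive_half f t l -> continuity_pt (fun s => f (Rmax 0 s)) t.
Proof.
move=> t0 /(half_deriveP _ _ t0) [F [HF EF]].
apply: (continuity_pt_ext (fun s => F (Rmax 0 s))).
  by move=> s; rewrite EF //; apply: Rmax_l.
apply: (continuity_pt_comp (Rmax 0) F).
  (* [Rmax 0 s] equals [(s + Rabs s) / 2], whose continuity reduces to that of the absolute
     value. *)
  apply: (continuity_pt_ext (fun s => (s + Rabs s) / 2)).
    by move=> s; rewrite /Rmax /Rabs; case: Rle_dec; case: Rcase_abs => /=; lra.
  apply: continuity_pt_mult; last exact: continuity_pt_const.
  apply: continuity_pt_plus; last exact: Rcontinuity_abs.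
  exact: derivable_continuous_pt (derivable_pt_id t).
rewrite Rmax_right //.
apply/continuity_pt_filterlim; apply: ex_derive_continuous.
by exists l.
Qed.

Lemma half_line_mono (f df : R -> R) (t : R) : 0 <= t ->
  (forall s, 0 <= s <= t -> is_derive_half f s (df s)) ->
  (forall s, 0 <= s <= t -> 0 <= df s) -> f 0 <= f t.
Proof.
move=> t0 Hd Hp.
have [c [Hc]] : exists c, Rmin 0 t <= c <= Rmax 0 t /\
    f (Rmax 0 t) - f (Rmax 0 0) = df c * (t - 0).
  apply: (MVT_gen (fun s => f (Rmax 0 s)) 0 t df) => s.
    rewrite Rmin_left // Rmax_right // => Hs.
    have s0 : 0 < s by lra.
    apply: (is_derive_ext_loc f); last first.
      by apply/is_derive_half_pos => //; apply: Hd; lra.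
    have : locally s (fun x => 0 < x) by apply: open_gt.
    by apply: filter_imp => x x0; rewrite Rmax_right //; lra.
  rewrite Rmin_left // Rmax_right // => Hs.
  apply: is_derive_half_continuous (Hd _ Hs); lra.
rewrite (Rmax_right 0 t) // Rmax_left; last lra.
move: Hc; rewrite Rmin_left // Rmax_right // => Hc.
have := Rmult_le_pos _ _ (Hp c Hc) t0; lra.
Qed.

Lemma is_derive_half_bound (u du G dG : R -> R) (t : R) : 0 <= t ->
  (forall s, 0 <= s <= t -> is_derive_half u s (du s)) ->
  (forall s, 0 <= s <= t -> is_derive G s (dG s)) ->
  (forall s, 0 <= s <= t -> Rabs (du s) <= dG s) ->
  Rabs (u 0) <= G 0 -> Rabs (u t) <= G t.
Proof.
move=> t0 Hu HG Hle H0.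
have key c : Rabs c = 1 -> c * u t <= G t.
  move=> c1.
  have cle x : c * x <= Rabs x.
    by rewrite -(Rmult_1_l (Rabs x)) -c1 -Rabs_mult; apply: Rle_abs.
  suff : G 0 + (- c) * u 0 <= G t + (- c) * u t by have := cle (u 0); lra.
  apply: (half_line_mono (f := fun s => G s + (- c) * u s) (df := fun s => dG s + (- c) * du s)) => //.
    move=> s Hs; apply: is_derive_half_plus; [lra | | apply: is_derive_half_scal; [lra | exact: Hu]].
    by apply: is_derive_is_derive_half; [lra | exact: HG].
  by move=> s Hs; have := Hle s Hs; have := cle (du s); lra.
apply: Rabs_le; split.
  by have := key (-1); rewrite Rabs_Ropp Rabs_R1; lra.
by have := key 1; rewrite Rabs_R1; lra.
Qed.

(* The weight [exp (s / m)] turns the bound on [m y' + y] into monotonicity of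
   [exp (s / m) * (G - y)], where [G] solves the relaxation equation whose
   right-hand side is the bound. *)
Lemma relaxation_bound (m a b : R) (k : nat) (y dy : R -> R) (t : R) :
  0 < m -> 0 <= t -> 0 <= a -> 0 <= b ->
  (forall s, 0 <= s <= t -> is_derive_half y s (dy s)) ->
  Rabs (y 0) <= a ->
  (forall s, 0 <= s <= t ->
     Rabs (m * dy s + y s)
       <= INR k * a * (1 + s / m) ^ (k.-1) * exp (- s / m) + b) ->
  Rabs (y t) <= a * (1 + t / m) ^ k * exp (- t / m) + b * (1 - exp (- t / m)).
Proof.
move=> m0 t0 a0 b0 Hy H0 Hg.
have E s : exp (s / m) * exp (- s / m) = 1.
  by rewrite -exp_plus -exp_0; congr exp; field; lra.
suff : Rabs (exp (t / m) * y t) <= a * (1 + t / m) ^ k + b * (exp (t / m) - 1).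
  have ep := exp_pos (t / m); have en := exp_pos (- t / m).
  rewrite Rabs_mult (Rabs_pos_eq (exp _)); last lra.
  move=> H; have := Rmult_le_compat_r _ _ _ (Rlt_le _ _ en) H.
  have -> : exp (t / m) * Rabs (y t) * exp (- t / m) =
            (exp (t / m) * exp (- t / m)) * Rabs (y t) by ring.
  have -> : (a * (1 + t / m) ^ k + b * (exp (t / m) - 1)) * exp (- t / m) =
    a * (1 + t / m) ^ k * exp (- t / m) +
    b * (exp (t / m) * exp (- t / m) - exp (- t / m)) by ring.
  by rewrite E Rmult_1_l.
apply: (is_derive_half_bound (u := fun s => exp (s / m) * y s)
  (du := fun s => (exp (s / m) / m) * y s + exp (s / m) * dy s)
  (G := fun s => a * (1 + s / m) ^ k + b * (exp (s / m) - 1))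
  (dG := fun s => a * (INR k * (1 / m) * (1 + s / m) ^ (k.-1)) + b * (exp (s / m) / m))) => //.
- move=> s Hs; apply: is_derive_half_mult; [lra | | exact: Hy].
  apply: is_derive_is_derive_half; first lra.
  by auto_derive => //; rewrite /Rdiv; field; lra.
- move=> s Hs; auto_derive => //.
  by rewrite -[Nat.pred k]/(k.-1) /Rdiv; field; lra.
- move=> s Hs; have es := exp_pos (s / m).
  have -> : exp (s / m) / m * y s + exp (s / m) * dy s =
            exp (s / m) / m * (m * dy s + y s) by field; lra.
  have em : 0 < exp (s / m) / m by apply: Rdiv_lt_0_compat.
  rewrite Rabs_mult (Rabs_pos_eq (_ / m)); last lra.
  have := Rmult_le_compat_l _ _ _ (Rlt_le _ _ em) (Hg s Hs).
  set A := (1 + s / m) ^ _.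
  have -> : exp (s / m) / m * (INR k * a * A * exp (- s / m) + b) =
    (exp (s / m) * exp (- s / m)) * (INR k * a * A / m) + b * (exp (s / m) / m).
    by field; lra.
  rewrite E; lra.
- have -> : 0 / m = 0 by field; lra.
  by rewrite exp_0 Rplus_0_r pow1 Rmult_1_l; lra.
Qed.

(** This is the case [k = 0]: the factor [INR k] removes the layer part of the forcing, whatever the
    truncated exponent [k.-1] is. *)
Lemma relaxation_bound0 (m a b : R) (y dy : R -> R) (t : R) :
  0 < m -> 0 <= t -> 0 <= a -> 0 <= b ->
  (forall s, 0 <= s <= t -> is_derive_half y s (dy s)) ->
  Rabs (y 0) <= a ->
  (forall s, 0 <= s <= t -> Rabs (m * dy s + y s) <= b) ->
  Rabs (y t) <= a * exp (- t / m) + b * (1 - exp (- t / m)).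
Proof.
move=> m0 t0 a0 b0 Hy H0 Hg; rewrite -[a in a * exp _]Rmult_1_r.
apply: (relaxation_bound (k := 0) (dy := dy)) => // s Hs.
by rewrite !Rmult_0_l Rplus_0_l; exact: Hg.
Qed.

(** * Smooth functions on the half-line *)

(** The recursion peels off the innermost derivative, in step with [Derive_half_nS], so that a
    differential equation [f' = F(f)] yields regularity by induction on [n] through
    [smooth_derive]. *)
Fixpoint smooth (n : nat) (f : R -> R) : Prop :=
  if n is p.+1 then
    (forall t, 0 <= t -> ex_derive_half f t) /\ smooth p (Derive_half f)
  else True.

Lemma Derive_half_correct (f : R -> R) (t : R) :
  0 <= t -> ex_derive_half f t -> is_derive_half f t (Derive_half f t).
Proof. by move=> t0 [l Hl]; rewrite (is_derive_half_unique t0 Hl). Qed.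

(** Values at negative arguments, including those of [Derive_half], are arbitrary; agreement on the
    half-line is therefore the right notion of equality throughout. *)
Lemma Derive_half_ext (f g : R -> R) (t : R) : 0 <= t ->
  (forall s, 0 <= s -> f s = g s) -> ex_derive_half f t ->
  Derive_half f t = Derive_half g t.
Proof.
move=> t0 E Hf; symmetry; apply: (is_derive_half_unique t0).
exact: is_derive_half_ext E (Derive_half_correct t0 Hf).
Qed.

Lemma smooth_ext (n : nat) (f g : R -> R) :
  (forall s, 0 <= s -> f s = g s) -> smooth n f -> smooth n g.
Proof.
elim: n f g => [//|n IH] f g E [Hf Hn]; split.
  move=> t t0; have [l Hl] := Hf t t0; exists l; exact: is_derive_half_ext E Hl.
by apply: IH Hn => s s0; apply: Derive_half_ext => //; exact: Hf.
Qed.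

Lemma smooth_derive (n : nat) (f df : R -> R) :
  (forall t, 0 <= t -> is_derive_half f t (df t)) -> smooth n df -> smooth n.+1 f.
Proof.
move=> H Hn; split; first by move=> t t0; exists (df t); exact: H.
apply: smooth_ext Hn => s s0; symmetry; exact: is_derive_half_unique (H s s0).
Qed.

Lemma smoothW (n : nat) (f : R -> R) : smooth n.+1 f -> smooth n f.
Proof. by elim: n f => [//|n IH] f [Hf Hn]; split=> //; exact: IH. Qed.

Lemma smooth_is_derive (n : nat) (f : R -> R) (t : R) : 0 <= t ->
  smooth n.+1 f -> is_derive_half f t (Derive_half f t).
Proof. by move=> t0 [Hf _]; apply: Derive_half_correct => //; exact: Hf. Qed.

Lemma smooth_plus (n : nat) (f g : R -> R) :
  smooth n f -> smooth n g -> smooth n (fun s => f s + g s).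
Proof.
elim: n f g => [//|n IH] f g Hf Hg.
apply: (smooth_derive (df := fun s => Derive_half f s + Derive_half g s)).
  by move=> t t0; apply: is_derive_half_plus; rewrite //; [exact: (smooth_is_derive t0 Hf) | exact: (smooth_is_derive t0 Hg)].
by apply: IH; [case: Hf | case: Hg].
Qed.

Lemma smooth_scal (n : nat) (f : R -> R) (c : R) :
  smooth n f -> smooth n (fun s => c * f s).
Proof.
elim: n f => [//|n IH] f Hf.
apply: (smooth_derive (df := fun s => c * Derive_half f s)).
  by move=> t t0; apply: is_derive_half_scal; rewrite //; exact: (smooth_is_derive t0 Hf).
by apply: IH; case: Hf.
Qed.

Lemma smooth_const (n : nat) (c : R) : smooth n (fun=> c).
Proof.
elim: n c => [//|n IH] c; apply: (smooth_derive (df := fun=> 0)) => // t t0.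
by apply: is_derive_is_derive_half => //; exact: is_derive_const.
Qed.

Lemma smooth_minus (n : nat) (f g : R -> R) :
  smooth n f -> smooth n g -> smooth n (fun s => f s - g s).
Proof.
move=> Hf Hg; have := smooth_plus Hf (smooth_scal (-1) Hg).
by apply: smooth_ext => s _; ring.
Qed.

Lemma smooth_mult (n : nat) (f g : R -> R) :
  smooth n f -> smooth n g -> smooth n (fun s => f s * g s).
Proof.
elim: n f g => [//|n IH] f g Hf Hg.
apply: (smooth_derive (df := fun s => Derive_half f s * g s + f s * Derive_half g s)).
  by move=> t t0; apply: is_derive_half_mult; rewrite //; [exact: (smooth_is_derive t0 Hf) | exact: (smooth_is_derive t0 Hg)].
apply: smooth_plus; apply: IH; first [exact: smoothW | by case: Hf | by case: Hg].
Qed.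

Lemma is_derive_half_sin (f : R -> R) (t l : R) : 0 <= t ->
  is_derive_half f t l -> is_derive_half (fun s => sin (f s)) t (cos (f t) * l).
Proof. by move=> t0 Hf; apply: is_derive_half_comp => //; exact: is_derive_sin. Qed.

Lemma is_derive_half_cos (f : R -> R) (t l : R) : 0 <= t ->
  is_derive_half f t l -> is_derive_half (fun s => cos (f s)) t (- sin (f t) * l).
Proof. by move=> t0 Hf; apply: is_derive_half_comp => //; exact: is_derive_cos. Qed.

Lemma smooth_sin_cos (n : nat) (f : R -> R) : smooth n f ->
  smooth n (fun s => sin (f s)) /\ smooth n (fun s => cos (f s)).
Proof.
elim: n f => [//|n IH] f Hf.
have [Hs Hc] := IH _ (smoothW Hf).
have Hd : smooth n (Derive_half f) by case: Hf.
split.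
  apply: (smooth_derive (df := fun s => cos (f s) * Derive_half f s)).
    by move=> t t0; apply: is_derive_half_sin (smooth_is_derive t0 Hf).
  exact: smooth_mult.
apply: (smooth_derive (df := fun s => - sin (f s) * Derive_half f s)).
  by move=> t t0; apply: is_derive_half_cos (smooth_is_derive t0 Hf).
apply: smooth_mult => //; have := smooth_scal (-1) Hs.
by apply: smooth_ext => s _; ring.
Qed.

Lemma Derive_half_nS (n : nat) (f : R -> R) :
  Derive_half_n n.+1 f = Derive_half_n n (Derive_half f).
Proof. exact: iterSr. Qed.

Lemma Derive_half_n_ext (n : nat) (f g : R -> R) (t : R) : 0 <= t ->
  (forall s, 0 <= s -> f s = g s) -> smooth n f ->
  Derive_half_n n f t = Derive_half_n n g t.
Proof.
move=> t0; elim: n f g => [|n IH] f g E Hf; first exact: E.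
rewrite !Derive_half_nS; case: Hf => [Hf Hn]; apply: IH Hn => s s0.
by apply: Derive_half_ext => //; exact: Hf.
Qed.

Lemma Derive_half_nS_eq (n : nat) (f df : R -> R) (t : R) : 0 <= t ->
  (forall s, 0 <= s -> is_derive_half f s (df s)) -> smooth n df ->
  Derive_half_n n.+1 f t = Derive_half_n n df t.
Proof.
move=> t0 H Hn; rewrite Derive_half_nS; symmetry; apply: Derive_half_n_ext => // s s0.
symmetry; exact: is_derive_half_unique (H s s0).
Qed.

Lemma smooth_Derive_half_n (k n : nat) (f : R -> R) :
  smooth (k + n)%N f -> smooth n (Derive_half_n k f).
Proof.
elim: k f => [//|k IH] f; rewrite Derive_half_nS addSn => -[_ H]; exact: IH.
Qed.

Lemma is_derive_half_Derive_half_n (n : nat) (f : R -> R) (t : R) : 0 <= t ->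
  smooth n.+1 f -> is_derive_half (Derive_half_n n f) t (Derive_half_n n.+1 f t).
Proof.
move=> t0 Hf.
have H : smooth 1 (Derive_half_n n f) by apply: smooth_Derive_half_n; rewrite addn1.
exact: (smooth_is_derive t0 H).
Qed.

Lemma Derive_half_n_plus (n : nat) (f g : R -> R) (t : R) : 0 <= t ->
  smooth n f -> smooth n g ->
  Derive_half_n n (fun s => f s + g s) t = Derive_half_n n f t + Derive_half_n n g t.
Proof.
move=> t0; elim: n f g => [//|n IH] f g Hf Hg.
have [[_ Hf'] [_ Hg']] := (Hf, Hg).
rewrite (Derive_half_nS_eq (n := n) (df := fun s => Derive_half f s + Derive_half g s)) //.
- by rewrite !Derive_half_nS IH.
- by move=> s s0; apply: is_derive_half_plus; rewrite //; [exact: (smooth_is_derive s0 Hf) | exact: (smooth_is_derive s0 Hg)].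
- exact: smooth_plus.
Qed.

Lemma Derive_half_n_scal (n : nat) (f : R -> R) (c t : R) : 0 <= t ->
  smooth n f -> Derive_half_n n (fun s => c * f s) t = c * Derive_half_n n f t.
Proof.
move=> t0; elim: n f => [//|n IH] f Hf; have [_ Hf'] := Hf.
rewrite (Derive_half_nS_eq (n := n) (df := fun s => c * Derive_half f s)) //.
- by rewrite !Derive_half_nS IH.
- by move=> s s0; apply: is_derive_half_scal; rewrite //; exact: (smooth_is_derive s0 Hf).
- exact: smooth_scal.
Qed.

Lemma Derive_half_n_minus (n : nat) (f g : R -> R) (t : R) : 0 <= t ->
  smooth n f -> smooth n g ->
  Derive_half_n n (fun s => f s - g s) t = Derive_half_n n f t - Derive_half_n n g t.
Proof.
move=> t0 Hf Hg; rewrite (Derive_half_n_ext (n := n) (g := fun s => f s + (-1) * g s)) //.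
- by rewrite Derive_half_n_plus ?Derive_half_n_scal //; [ring | exact: smooth_scal].
- by move=> s _; ring.
- exact: smooth_minus.
Qed.

Lemma Derive_half_nS_const (n : nat) (c t : R) : 0 <= t ->
  Derive_half_n n.+1 (fun=> c) t = 0.
Proof.
move=> t0; elim: n c => [|n IH] c.
  by apply: is_derive_half_unique => //; apply: is_derive_is_derive_half => //; exact: is_derive_const.
rewrite (Derive_half_nS_eq (n := n.+1) (df := fun=> 0)) //; last exact: smooth_const.
by move=> s s0; apply: is_derive_is_derive_half => //; exact: is_derive_const.
Qed.

Lemma smooth_sum (n : nat) (I : Type) (r : seq I) (f : I -> R -> R) :
  (forall i, smooth n (f i)) -> smooth n (fun s => \big[Rplus/0]_(i <- r) f i s).
Proof.
move=> Hf; elim: r => [|i r IH].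
  by apply: (smooth_ext (f := fun=> 0)); [move=> s _; rewrite big_nil | exact: smooth_const].
have := smooth_plus (Hf i) IH.
by apply: smooth_ext => s _; rewrite big_cons.
Qed.

Lemma Derive_half_n_sum (n : nat) (I : Type) (r : seq I) (f : I -> R -> R) (t : R) :
  0 <= t -> (forall i, smooth n (f i)) ->
  Derive_half_n n (fun s => \big[Rplus/0]_(i <- r) f i s) t =
  \big[Rplus/0]_(i <- r) Derive_half_n n (f i) t.
Proof.
move=> t0 Hf; elim: r => [|i r IH].
  rewrite big_nil (Derive_half_n_ext (n := n) (g := fun=> 0)) //; last exact: smooth_sum.
    by case: n Hf => [//|n] _; rewrite Derive_half_nS_const.
  by move=> s _; rewrite big_nil.
rewrite big_cons -IH -Derive_half_n_plus //; last exact: smooth_sum.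
apply: Derive_half_n_ext => //; last exact: smooth_sum.
by move=> s _; rewrite big_cons.
Qed.

(** * Majorants for higher derivatives *)

HB.instance Definition _ := Monoid.isComLaw.Build R 0 Rplus
  (fun x y z => esym (Rplus_assoc x y z)) Rplus_comm Rplus_0_l.
HB.instance Definition _ := Monoid.isMulLaw.Build R 0 Rmult Rmult_0_l Rmult_0_r.
HB.instance Definition _ := Monoid.isAddLaw.Build R Rmult Rplus
  Rmult_plus_distr_r Rmult_plus_distr_l.

Lemma big_Rplus_le (I : finType) (f g : I -> R) :
  (forall i, f i <= g i) -> \big[Rplus/0]_i f i <= \big[Rplus/0]_i g i.
Proof.
move=> H; apply: (big_ind2 (fun x y => x <= y)) => //; first exact: Rle_refl.
by move=> *; apply: Rplus_le_compat.
Qed.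

Lemma big_Rplus_abs (I : finType) (f : I -> R) :
  Rabs (\big[Rplus/0]_i f i) <= \big[Rplus/0]_i Rabs (f i).
Proof.
apply: (big_ind2 (fun x y => Rabs x <= y)); first by rewrite Rabs_R0; exact: Rle_refl.
  by move=> x1 x2 y1 y2 H1 H2; apply: Rle_trans (Rabs_triang _ _) _; lra.
by move=> i _; exact: Rle_refl.
Qed.

Lemma fact_ge1 (n : nat) : 1 <= INR n`!.
Proof. by rewrite -[1]/(INR 1); apply: le_INR; apply/leP; exact: fact_gt0. Qed.

Lemma INR_1 : INR 1 = 1.
Proof. by []. Qed.

Lemma INR_factS (n : nat) : INR (n.+1)`! = INR n.+1 * INR n`!.
Proof. by rewrite factS; exact: mult_INR. Qed.

(** The Cauchy product of power series. Its arguments majorize Taylor coefficients [f^(k) / k!],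
    which removes the binomials from Leibniz' rule. *)
Definition conv (a b : nat -> R) (n : nat) : R :=
  \big[Rplus/0]_(k < n.+1) (a k * b (n - k)%N).

(** This is [A' B + A B' = (A B)'] for formal power series, read at degree [n]; the weight [n + 1]
    is distributed as [k + (n + 1 - k)] over the two factors. *)
Lemma conv_derive (a b : nat -> R) (n : nat) :
  conv (fun k => INR k.+1 * a k.+1) b n + conv a (fun k => INR k.+1 * b k.+1) n
    = INR n.+1 * conv a b n.+1.
Proof.
rewrite /conv big_distrr /=.
rewrite [RHS](eq_bigr (fun k : 'I_n.+2 =>
  INR k * a k * b (n.+1 - k)%N + a k * (INR (n.+1 - k)%N * b (n.+1 - k)%N))); last first.
  move=> k _; have kn : (k <= n.+1)%N by rewrite -ltnS.
  have -> : INR n.+1 = INR k + INR (n.+1 - k)%N by rewrite -plus_INR -[Nat.add _ _]/(addn _ _) subnKC.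
  by rewrite /=; ring.
rewrite big_split /=; congr Rplus.
  rewrite [RHS]big_ord_recl /= Rmult_0_l Rmult_0_l Rplus_0_l.
  by apply: eq_bigr => k _.
rewrite [RHS]big_ord_recr /= subnn /= Rmult_0_l Rmult_0_r Rplus_0_r.
by apply: eq_bigr => k _; rewrite subSn // -ltnS.
Qed.

Definition mix (e a b : R) : R := e * a + (1 - e) * b.

(* Chebyshev's inequality for two comonotone two-valued variables. *)
Lemma mix_mul (e a b a' b' : R) : 0 <= e <= 1 -> b <= a -> b' <= a' ->
  mix e a b * mix e a' b' <= mix e (a * a') (b * b').
Proof.
move=> He Ha Hb.
have -> : mix e (a * a') (b * b') =
  mix e a b * mix e a' b' + e * (1 - e) * ((a - b) * (a' - b')) by rewrite /mix; ring.
have : 0 <= e * (1 - e) * ((a - b) * (a' - b')).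
  by apply: Rmult_le_pos; apply: Rmult_le_pos; lra.
lra.
Qed.

Lemma conv_mix (e : R) (a b a' b' : nat -> R) (n : nat) : 0 <= e <= 1 ->
  (forall k, b k <= a k) -> (forall k, b' k <= a' k) ->
  conv (fun k => mix e (a k) (b k)) (fun k => mix e (a' k) (b' k)) n
    <= mix e (conv a a' n) (conv b b' n).
Proof.
move=> He H H'; rewrite /mix /conv !big_distrr -big_split /=.
by apply: big_Rplus_le => k; exact: mix_mul.
Qed.

(** Induction on [n]: differentiating one factor replaces its majorant by that of the differentiated
    series, and [conv_derive] recombines the two terms. *)
Lemma Derive_half_n_mult_le (n : nat) (f g : R -> R) (a b : nat -> R) (s : R) :
  0 <= s -> smooth n f -> smooth n g ->
  (forall k, (k <= n)%N -> Rabs (Derive_half_n k f s) <= INR k`! * a k) ->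
  (forall k, (k <= n)%N -> Rabs (Derive_half_n k g s) <= INR k`! * b k) ->
  Rabs (Derive_half_n n (fun s => f s * g s) s) <= INR n`! * conv a b n.
Proof.
move=> s0; elim: n f g a b => [|n IH] f g a b Hf Hg Ha Hb.
  rewrite /conv big_ord1 /= Rabs_mult.
  have := Ha 0%N isT; have := Hb 0%N isT; rewrite /= !Rmult_1_l => B A.
  by apply: Rmult_le_compat => //; exact: Rabs_pos.
have [[_ Hf'] [_ Hg']] := (Hf, Hg).
have [Wf Wg] := (smoothW Hf, smoothW Hg).
rewrite (Derive_half_nS_eq (df := fun s => Derive_half f s * g s + f s * Derive_half g s)) //.
- rewrite Derive_half_n_plus //; try exact: smooth_mult.
  apply: Rle_trans (Rabs_triang _ _) _.
  rewrite INR_factS (Rmult_comm (INR n.+1)) Rmult_assoc -conv_derive Rmult_plus_distr_l.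
  apply: Rplus_le_compat; apply: IH => // k kn; rewrite -?Derive_half_nS.
  + by apply: Rle_trans (Ha _ _) _ => //; rewrite INR_factS; right; ring.
  + by apply: Hb; exact: leqW.
  + by apply: Ha; exact: leqW.
  + by apply: Rle_trans (Hb _ _) _ => //; rewrite INR_factS; right; ring.
- move=> t t0; apply: is_derive_half_mult; rewrite //.
  + exact: (smooth_is_derive t0 Hf).
  + exact: (smooth_is_derive t0 Hg).
- by apply: smooth_plus; exact: smooth_mult.
Qed.

(** Multiplying by the geometric series [x / (1 - x u)] turns coefficients into partial sums; this
    is where the partial sums in the estimate for differences of sines come from. *)
Lemma conv_geom (g : nat -> R) (x : R) (n : nat) :
  conv (fun k => g k * x ^ k) (fun k => x ^ k.+1) n
    = (\big[Rplus/0]_(k < n.+1) g k) * x ^ n.+1.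
Proof.
rewrite /conv big_distrl /=; apply: eq_bigr => k _.
have -> : x * x ^ n = x ^ k * x ^ (n - k).+1.
  by rewrite -pow_add -[Nat.add _ _]/(addn _ _) addnS subnKC // -ltnS.
by rewrite /=; ring.
Qed.

Lemma conv_geomS (g : nat -> R) (x : R) (n : nat) :
  conv (fun k => g k * x ^ k.+1) (fun k => x ^ k) n
    = (\big[Rplus/0]_(k < n.+1) g k) * x ^ n.+1.
Proof.
rewrite -conv_geom; apply: eq_bigr => k _ /=; ring.
Qed.

Lemma big_Rplus_const (n : nat) (c : R) : \big[Rplus/0]_(k < n) c = INR n * c.
Proof.
elim: n => [|n IH]; first by rewrite big_ord0 Rmult_0_l.
by rewrite big_ord_recr S_INR /= IH; ring.
Qed.

Lemma pow_le_mono (b a : R) (k : nat) : 0 <= b <= a -> b ^ k <= a ^ k.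
Proof. by move=> H; apply: pow_incr. Qed.

(** * Sine and cosine of a phase *)

Section Composition.

Variables (e x b s : R).
Hypotheses (He : 0 <= e <= 1) (Hb : 0 <= b <= x) (s0 : 0 <= s).

(* The majorant [x ^ k.+1] of [phi^(k.+1) / k!] is that of [- ln (1 - x u)],
   whose exponential is the geometric series. *)
Lemma Derive_half_n_sin_cos_le (n : nat) (phi : R -> R) :
  smooth n phi ->
  (forall k, (k < n)%N ->
     Rabs (Derive_half_n k.+1 phi s) <= INR k`! * mix e (x ^ k.+1) (b ^ k.+1)) ->
  forall k, (k <= n)%N ->
    Rabs (Derive_half_n k (fun t => sin (phi t)) s) <= INR k`! * mix e (x ^ k) (b ^ k) /\
    Rabs (Derive_half_n k (fun t => cos (phi t)) s) <= INR k`! * mix e (x ^ k) (b ^ k).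
Proof.
elim: n phi => [|n IH] phi Hphi Hd k.
  rewrite leqn0 => /eqP -> /=.
  have -> : 1 * mix e 1 1 = 1 by rewrite /mix; ring.
  by split; apply: Rabs_le; [exact: SIN_bound | exact: COS_bound].
have Wphi := smoothW Hphi.
have {}IH : forall k, (k <= n)%N -> _ := IH _ Wphi (fun k kn => Hd k (leqW kn)).
rewrite leq_eqVlt => /orP [/eqP -> | ]; last by rewrite ltnS; exact: IH.
have [Ssin Scos] := smooth_sin_cos Wphi.
have Sphi : smooth n (Derive_half phi) by case: Hphi.
have Hconv : conv (fun k => mix e (x ^ k) (b ^ k)) (fun k => mix e (x ^ k.+1) (b ^ k.+1)) n
    <= INR n.+1 * mix e (x ^ n.+1) (b ^ n.+1).
  apply: Rle_trans (conv_mix _ He _ _) _; try by move=> *; exact: pow_le_mono.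
  have E y : conv (pow y) (fun k => y ^ k.+1) n = INR n.+1 * y ^ n.+1.
    have := conv_geom (fun=> 1) y n; rewrite big_Rplus_const Rmult_1_r => <-.
    by apply: eq_bigr => i _ /=; ring.
  by rewrite !E /mix; right; ring.
have fin u : u <= INR n`! * conv (fun k => mix e (x ^ k) (b ^ k))
    (fun k => mix e (x ^ k.+1) (b ^ k.+1)) n ->
    u <= INR (n.+1)`! * mix e (x ^ n.+1) (b ^ n.+1).
  move=> Hu; apply: Rle_trans Hu _; rewrite INR_factS (Rmult_comm (INR n.+1)) Rmult_assoc.
  by apply: Rmult_le_compat_l Hconv; have := fact_ge1 n; lra.
split.
- rewrite (Derive_half_nS_eq (df := fun t => cos (phi t) * Derive_half phi t)) //.
  + apply: fin; apply: Derive_half_n_mult_le => // k' kn.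
      by case: (IH _ kn).
    by rewrite -Derive_half_nS; exact: Hd.
  + by move=> t t0; apply: is_derive_half_sin; rewrite //; exact: (smooth_is_derive t0 Hphi).
  + exact: smooth_mult.
- rewrite (Derive_half_nS_eq (df := fun t => (-1) * (sin (phi t) * Derive_half phi t))) //.
  + rewrite Derive_half_n_scal //; last exact: smooth_mult.
    rewrite Rabs_mult Rabs_Ropp Rabs_R1 Rmult_1_l.
    apply: fin; apply: Derive_half_n_mult_le => // k' kn.
      by case: (IH _ kn).
    by rewrite -Derive_half_nS; exact: Hd.
  + move=> t t0; have := is_derive_half_cos t0 (smooth_is_derive t0 Hphi).
    by congr is_derive_half; ring.
  + by apply: smooth_scal; exact: smooth_mult.
Qed.

Lemma Rabs_sin_sub (u v : R) : Rabs (sin u - sin v) <= Rabs (u - v).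
Proof.
have [c [_]] := MVT_gen sin v u cos (fun y _ => is_derive_sin y)
  (fun y _ => continuity_sin y).
move=> ->; rewrite Rabs_mult; have := Rabs_pos (u - v).
have : Rabs (cos c) <= 1 by apply: Rabs_le; exact: COS_bound.
move=> H1 H2; have := Rmult_le_compat_r _ _ _ H2 H1; lra.
Qed.

Lemma Rabs_cos_sub (u v : R) : Rabs (cos u - cos v) <= Rabs (u - v).
Proof.
rewrite -!sin_shift; apply: Rle_trans (Rabs_sin_sub _ _) _.
by rewrite Rabs_minus_sym; right; congr Rabs; ring.
Qed.

(** With [A = sum g_k u^k] and [S = A / (1 - u)], this is the coefficient of [u^n] in
    [S' = S / (1 - u) + A' / (1 - u)]. *)
Lemma big_partial_sums (g : nat -> R) (n : nat) :
  \big[Rplus/0]_(k < n.+1) \big[Rplus/0]_(l < k.+1) g l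
    + \big[Rplus/0]_(k < n.+1) (INR k.+1 * g k.+1)
  = INR n.+1 * \big[Rplus/0]_(l < n.+2) g l.
Proof.
elim: n => [|n IH].
  by rewrite !big_ord_recr !big_ord0 /= -[INR 1]/1; ring.
rewrite big_ord_recr [X in _ + X]big_ord_recr /=.
set P := \big[Rplus/0]_(i < n.+1) _; set Q := \big[Rplus/0]_(i < n.+1) _.
rewrite [X in _ = _ * X]big_ord_recr /=; move: IH; rewrite -/P -/Q.
set G := \big[Rplus/0]_(l < n.+2) _; rewrite !S_INR => IH.
have -> : P = (INR n + 1) * G - Q by lra.
by ring.
Qed.

(** Order [n + 1] for the sine requires order [n] for the cosine and conversely, hence the joint
    conclusion. The majorants of the two halves of the product rule add up to exactly the next
    partial sum by [big_partial_sums], so nothing is lost in the induction. The order [h k <= g k]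
    is the comonotonicity that [mix_mul] needs. *)
Lemma Derive_half_n_sin_cos_sub_le (n : nat) (phi psi : R -> R) (g h : nat -> R) :
  smooth n phi -> smooth n psi -> (forall k, 0 <= h k <= g k) ->
  (forall k, (k < n)%N ->
     Rabs (Derive_half_n k.+1 phi s) <= INR k`! * mix e (x ^ k.+1) (b ^ k.+1)) ->
  (forall k, (k < n)%N ->
     Rabs (Derive_half_n k.+1 psi s) <= INR k`! * mix e (x ^ k.+1) (b ^ k.+1)) ->
  (forall k, (k <= n)%N ->
     Rabs (Derive_half_n k phi s - Derive_half_n k psi s)
       <= INR k`! * mix e (g k * x ^ k) (h k * b ^ k)) ->
  let M := fun k => INR k`! *
     mix e ((\big[Rplus/0]_(l < k.+1) g l) * x ^ k) ((\big[Rplus/0]_(l < k.+1) h l) * b ^ k) in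
  forall k, (k <= n)%N ->
    Rabs (Derive_half_n k (fun t => sin (phi t)) s
          - Derive_half_n k (fun t => sin (psi t)) s) <= M k /\
    Rabs (Derive_half_n k (fun t => cos (phi t)) s
          - Derive_half_n k (fun t => cos (psi t)) s) <= M k.
Proof.
move=> + + Hgh + + + M; elim: n => [|n IH] Hphi Hpsi Bphi Bpsi Bd k.
  rewrite leqn0 => /eqP -> /=; rewrite /M !big_ord1 /=.
  have H0 := Bd 0%N isT; rewrite /= in H0.
  by split; apply: Rle_trans H0; [exact: Rabs_sin_sub | exact: Rabs_cos_sub].
have [Wphi Wpsi] := (smoothW Hphi, smoothW Hpsi).
have {}IH : forall k, (k <= n)%N -> _ := IH Wphi Wpsi (fun k kn => Bphi k (leqW kn))
   (fun k kn => Bpsi k (leqW kn)) (fun k kn => Bd k (leqW kn)).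
rewrite leq_eqVlt => /orP [/eqP -> | ]; last by rewrite ltnS; exact: IH.
have [Ssin Scos] := smooth_sin_cos Wphi.
have [Ssin' Scos'] := smooth_sin_cos Wpsi.
have Sphi : smooth n (Derive_half phi) by case: Hphi.
have Spsi : smooth n (Derive_half psi) by case: Hpsi.
have trig := Derive_half_n_sin_cos_le Wpsi (fun k kn => Bpsi k (leqW kn)).
have sum_ge0 j : 0 <= \big[Rplus/0]_(l < j.+1) h l <= \big[Rplus/0]_(l < j.+1) g l.
  split; last by apply: big_Rplus_le => l; case: (Hgh l).
  apply: (big_ind (fun y => 0 <= y)); [exact: Rle_refl | move=> *; lra | ].
  by move=> l _; case: (Hgh l).
have pw j : 0 <= b ^ j <= x ^ j.
  by split; [apply: pow_le; lra | exact: pow_le_mono].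
have mle u v y z : 0 <= u <= v -> 0 <= y <= z -> u * y <= v * z.
  by move=> *; apply: Rmult_le_compat; lra.
(* [c1] majorizes the difference of the outer functions times [phi']; [c2] majorizes [phi' - psi']
   times the outer function at [psi]. *)
pose c1 := conv (fun k => mix e ((\big[Rplus/0]_(l < k.+1) g l) * x ^ k)
    ((\big[Rplus/0]_(l < k.+1) h l) * b ^ k)) (fun k => mix e (x ^ k.+1) (b ^ k.+1)) n.
pose c2 := conv (fun k => mix e (INR k.+1 * g k.+1 * x ^ k.+1) (INR k.+1 * h k.+1 * b ^ k.+1))
    (fun k => mix e (x ^ k) (b ^ k)) n.
have Hsum : INR n`! * c1 + INR n`! * c2 <= M n.+1.
  have H1 : c1 <= mix e ((\big[Rplus/0]_(k < n.+1) \big[Rplus/0]_(l < k.+1) g l) * x ^ n.+1)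
     ((\big[Rplus/0]_(k < n.+1) \big[Rplus/0]_(l < k.+1) h l) * b ^ n.+1).
    have E (f : nat -> R) (y : R) : conv (fun k => (\big[Rplus/0]_(l < k.+1) f l) * y ^ k) (fun k => y ^ k.+1) n
      = (\big[Rplus/0]_(k < n.+1) \big[Rplus/0]_(l < k.+1) f l) * y ^ n.+1 by exact: conv_geom.
    rewrite -!E.
    by apply: conv_mix => // j; [apply: mle | case: (pw j.+1)].
  have H2 : c2 <= mix e ((\big[Rplus/0]_(k < n.+1) (INR k.+1 * g k.+1)) * x ^ n.+1)
     ((\big[Rplus/0]_(k < n.+1) (INR k.+1 * h k.+1)) * b ^ n.+1).
    have E (f : nat -> R) (y : R) : conv (fun k => INR k.+1 * f k.+1 * y ^ k.+1) (fun k => y ^ k) n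
      = (\big[Rplus/0]_(k < n.+1) (INR k.+1 * f k.+1)) * y ^ n.+1 by exact: conv_geomS.
    rewrite -!E.
    apply: conv_mix => // j; last by case: (pw j).
    apply: mle => //; have [h0 hg] := Hgh j.+1; have j0 := pos_INR j.+1.
    by split; [exact: Rmult_le_pos | exact: Rmult_le_compat_l].
  have f0 : 0 <= INR n`! by exact: pos_INR.
  have := Rmult_le_compat_l _ _ _ f0 (Rplus_le_compat _ _ _ _ H1 H2).
  rewrite Rmult_plus_distr_l => H; apply: Rle_trans H _; right.
  rewrite /M INR_factS /mix.
  have := big_partial_sums g n; have := big_partial_sums h n.
  set gg := \big[Rplus/0]_(k < n.+1) _; set gg' := \big[Rplus/0]_(k < n.+1) _.
  set hh := \big[Rplus/0]_(k < n.+1) _; set hh' := \big[Rplus/0]_(k < n.+1) _.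
  move=> Eg Eh.
  have -> : INR n`! * (e * (hh * x ^ n.+1) + (1 - e) * (gg * b ^ n.+1) +
    (e * (hh' * x ^ n.+1) + (1 - e) * (gg' * b ^ n.+1))) =
    INR n`! * (e * ((hh + hh') * x ^ n.+1) + (1 - e) * ((gg + gg') * b ^ n.+1)) by ring.
  by rewrite Eg Eh; ring.
have tri u v u' v' : Rabs u <= u' -> Rabs v <= v' -> u' + v' <= M n.+1 -> Rabs (u + v) <= M n.+1.
  by move=> *; apply: Rle_trans (Rabs_triang _ _) _; lra.
have smk f k' : (k' <= n)%N -> smooth n f -> smooth k' f.
  by move=> kn; rewrite -(subnK kn); elim: (n - k')%N => [//|p IHp] /smoothW.
have Bdiff k' : (k' <= n)%N ->
    Rabs (Derive_half_n k' (fun t => Derive_half phi t - Derive_half psi t) s) <=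
    INR k'`! * mix e (INR k'.+1 * g k'.+1 * x ^ k'.+1) (INR k'.+1 * h k'.+1 * b ^ k'.+1).
  move=> kn; rewrite Derive_half_n_minus //; try exact: smk.
  rewrite -!Derive_half_nS; apply: Rle_trans (Bd _ _) _ => //.
  by rewrite INR_factS /mix; right; ring.
have Bphi' k' : (k' <= n)%N -> Rabs (Derive_half_n k' (Derive_half phi) s)
    <= INR k'`! * mix e (x ^ k'.+1) (b ^ k'.+1).
  by rewrite -Derive_half_nS; exact: Bphi.
(* [(u v)' - (u0 v0)'] is split as [(u - u0) v' + u0 (v' - v0')]. *)
have split_mult u u0 c : smooth n u -> smooth n u0 -> Rabs c = 1 ->
    (forall k', (k' <= n)%N -> Rabs (Derive_half_n k' u s - Derive_half_n k' u0 s) <= M k') ->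
    (forall k', (k' <= n)%N -> Rabs (Derive_half_n k' u0 s) <= INR k'`! * mix e (x ^ k') (b ^ k')) ->
    Rabs (Derive_half_n n (fun t => c * (u t * Derive_half phi t)) s
          - Derive_half_n n (fun t => c * (u0 t * Derive_half psi t)) s) <= M n.+1.
  move=> Su Su0 c1' Hu Hu0.
  have Sm v w : smooth n v -> smooth n w -> smooth n (fun t => v t * w t) by exact: smooth_mult.
  rewrite !Derive_half_n_scal //; try exact: Sm.
  rewrite -Rmult_minus_distr_l Rabs_mult c1' Rmult_1_l -Derive_half_n_minus //; try exact: Sm.
  have S1 := smooth_minus Su Su0; have S2 := smooth_minus Sphi Spsi.
  rewrite (Derive_half_n_ext (g := fun t => (u t - u0 t) * Derive_half phi t
      + (Derive_half phi t - Derive_half psi t) * u0 t)) //; last first.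
  - by apply: smooth_minus; exact: Sm.
  - by move=> t _; ring.
  rewrite Derive_half_n_plus //; try exact: Sm.
  apply: (tri _ _ (INR n`! * c1) (INR n`! * c2)) Hsum.
    apply: Derive_half_n_mult_le => // k' kn.
    rewrite Derive_half_n_minus //; try exact: smk.
    exact: Hu.
  exact: Derive_half_n_mult_le.
split.
- rewrite (Derive_half_nS_eq (df := fun t => 1 * (cos (phi t) * Derive_half phi t))) //.
  + rewrite (Derive_half_nS_eq (f := fun t => sin (psi t)) (df := fun t => 1 * (cos (psi t) * Derive_half psi t))) //.
    * apply: split_mult => //; first exact: Rabs_R1.
        by move=> k' kn; case: (IH _ kn).
      by move=> k' kn; case: (trig _ kn).
    * move=> t t0; rewrite Rmult_1_l; exact: is_derive_half_sin (smooth_is_derive t0 Hpsi).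
    * by apply: smooth_scal; exact: smooth_mult.
  + move=> t t0; rewrite Rmult_1_l; exact: is_derive_half_sin (smooth_is_derive t0 Hphi).
  + by apply: smooth_scal; exact: smooth_mult.
- rewrite (Derive_half_nS_eq (df := fun t => (-1) * (sin (phi t) * Derive_half phi t))) //.
  + rewrite (Derive_half_nS_eq (f := fun t => cos (psi t)) (df := fun t => (-1) * (sin (psi t) * Derive_half psi t))) //.
    * apply: split_mult => //; first by rewrite Rabs_Ropp Rabs_R1.
        by move=> k' kn; case: (IH _ kn).
      by move=> k' kn; case: (trig _ kn).
    * move=> t t0; have := is_derive_half_cos t0 (smooth_is_derive t0 Hpsi).
      by congr is_derive_half; ring.
    * by apply: smooth_scal; exact: smooth_mult.
  + move=> t t0; have := is_derive_half_cos t0 (smooth_is_derive t0 Hphi).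
    by congr is_derive_half; ring.
  + by apply: smooth_scal; exact: smooth_mult.
Qed.

End Composition.

(** * Finite maxima and Gronwall's inequality *)

Lemma exp_le_mono (x y : R) : x <= y -> exp x <= exp y.
Proof. by case=> [/exp_increasing /Rlt_le // | ->]; exact: Rle_refl. Qed.

Lemma In_mem (I : finType) (f : I -> R) (y : R) :
  List.In y (map f (enum I)) <-> exists i, y = f i.
Proof.
have H (r : seq I) : List.In y (map f r) <-> exists2 i, i \in r & y = f i.
  elim: r => [|a r IH] /=; first by split=> // -[].
  rewrite IH; split.
    case=> [<- | [i ir ->]]; first by exists a; rewrite ?mem_head.
    by exists i => //; rewrite in_cons ir orbT.
  by case=> i; rewrite in_cons => /orP [/eqP -> -> | ir ->]; [left | right; exists i].
rewrite H; split; first by case=> i _ ->; exists i.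
by case=> i ->; exists i => //; rewrite mem_enum.
Qed.

Lemma finite_bound (I : finType) (f : I -> R) : exists K, forall i, f i <= K.
Proof.
exists (MaxRlist (map f (enum I))) => i.
by apply: MaxRlist_P1; apply/In_mem; exists i.
Qed.

Lemma le_vmax (N : nat) (X : 'I_N -> R) (i : 'I_N) : X i <= vmax X.
Proof. by apply: MaxRlist_P1; apply/In_mem; exists i. Qed.

Lemma vmin_le (N : nat) (X : 'I_N -> R) (i : 'I_N) : vmin X <= X i.
Proof. by apply: MinRlist_P1; apply/In_mem; exists i. Qed.

Lemma vmax_attained (N : nat) (X : 'I_N -> R) : (0 < N)%N -> exists i, vmax X = X i.
Proof.
move=> N0; apply/In_mem; apply: MaxRlist_P2; exists (X (Ordinal N0)); apply/In_mem.
by exists (Ordinal N0).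
Qed.

Lemma MinRlist_In (x : R) (l : list R) : List.In (MinRlist (x :: l)) (x :: l).
Proof.
elim: l x => [|y l IH] x; first by left.
rewrite -[MinRlist _]/(Rmin x (MinRlist (y :: l))).
by rewrite /Rmin; case: Rle_dec => _; [left | right; exact: IH].
Qed.

Lemma vmin_attained (N : nat) (X : 'I_N -> R) : (0 < N)%N -> exists i, vmin X = X i.
Proof.
move=> N0; apply/In_mem.
have : List.In (X (Ordinal N0)) (map X (enum 'I_N)) by apply/In_mem; exists (Ordinal N0).
by rewrite /vmin; case: (map _ _) => // x l _; exact: MinRlist_In.
Qed.

Lemma norm_inf_ge (N : nat) (X : 'I_N -> R) (i : 'I_N) : Rabs (X i) <= norm_inf X.
Proof. exact: (le_vmax (fun i => Rabs (X i))). Qed.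

Lemma diam_ge (N : nat) (X : 'I_N -> R) (i j : 'I_N) : Rabs (X i - X j) <= diam X.
Proof.
apply: Rle_trans (le_vmax (fun i => vmax (fun j => Rabs (X i - X j))) i).
exact: (le_vmax (fun j => Rabs (X i - X j))).
Qed.

Lemma norm_inf_attained (N : nat) (X : 'I_N -> R) : (0 < N)%N ->
  exists i, norm_inf X = Rabs (X i).
Proof. exact: (vmax_attained (fun i => Rabs (X i))). Qed.

Lemma diam_attained (N : nat) (X : 'I_N -> R) : (0 < N)%N ->
  exists i j, diam X = Rabs (X i - X j).
Proof.
move=> N0; have [i Hi] := vmax_attained (fun i => vmax (fun j => Rabs (X i - X j))) N0.
have [j Hj] := vmax_attained (fun j => Rabs (X i - X j)) N0.
by exists i, j; rewrite /diam Hi Hj.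
Qed.

Lemma diam_ge0 (N : nat) (X : 'I_N -> R) : (0 < N)%N -> 0 <= diam X.
Proof. by move=> N0; apply: Rle_trans (diam_ge X (Ordinal N0) (Ordinal N0)); exact: Rabs_pos. Qed.

Lemma norm_inf_ge0 (N : nat) (X : 'I_N -> R) : (0 < N)%N -> 0 <= norm_inf X.
Proof. by move=> N0; apply: Rle_trans (norm_inf_ge X (Ordinal N0)); exact: Rabs_pos. Qed.

(** Every entry lies within half the range of the midrange. This is the source of the midrange of
    [omega0 - nu] in the first estimate. *)
Lemma Rabs_le_midrange (N : nat) (X : 'I_N -> R) (i : 'I_N) :
  Rabs (X i) <= Rabs ((vmax X + vmin X) / 2) + diam X / 2.
Proof.
have N0 : (0 < N)%N by case: N X i => [? []|].
have [a Ha] := vmax_attained X N0; have [b Hb] := vmin_attained X N0.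
have := diam_ge X a b; rewrite -Ha -Hb.
have := le_vmax X i; have := vmin_le X i.
by rewrite /Rabs; do !case: Rcase_abs; lra.
Qed.

(* Let [M] be the supremum of [(|u_p| + c) exp (- L s)] on [[0, t]]. Integrating
   the hypothesis gives [M <= M - (M - c) exp (- L t)], that is [M <= c]. *)
Lemma gronwall_family (I : finType) (u du : I -> R -> R) (L c : R) :
  0 < c -> 0 < L ->
  (forall p s, 0 <= s -> is_derive_half (u p) s (du p s)) ->
  (forall p, u p 0 = 0) ->
  (forall s M p, 0 <= s -> (forall q, Rabs (u q s) <= M) ->
     Rabs (du p s) <= L * (M + c)) ->
  forall p t, 0 <= t -> Rabs (u p t) <= c * (exp (L * t) - 1).
Proof.
move=> c0 L0 Hu H0 Hdu p t t0.
(* Taking the supremum over the index and the time together avoids differentiating the maximum of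
   the [Rabs (u q s)], which need not be differentiable. *)
pose E x := exists q s, 0 <= s <= t /\ x = (Rabs (u q s) + c) * exp (- (L * s)).
have [K HK] : exists K, forall q s, 0 <= s <= t -> Rabs (u q s) <= K.
  have Hq q : exists k, forall s, 0 <= s <= t -> Rabs (u q s) <= k.
    have [x [Hx _]] := continuity_ab_maj (fun s => Rabs (u q (Rmax 0 s))) 0 t t0
      (fun s Hs => continuity_pt_comp _ Rabs s
         (is_derive_half_continuous (proj1 Hs) (Hu q s (proj1 Hs))) (Rcontinuity_abs _)).
    exists (Rabs (u q (Rmax 0 x))) => s Hs; have := Hx s Hs.
    by rewrite (Rmax_right 0 s) //; lra.
  have [k Hk] := fin_all_exists Hq; have [K HK] := finite_bound k.
  by exists K => q s Hs; apply: Rle_trans (HK q); exact: Hk.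
have Eb : bound E.
  exists ((K + c) * 1) => x [q [s [Hs ->]]].
  have e1 : exp (- (L * s)) <= 1.
    rewrite -exp_0; apply: exp_le_mono.
    by have := Rmult_le_pos _ _ (Rlt_le _ _ L0) (proj1 Hs); lra.
  apply: Rmult_le_compat e1; [| exact: Rlt_le (exp_pos _) | by have := HK q s Hs; lra].
  by have := Rabs_pos (u q s); lra.
(* Time 0 contributes the value [c]; this gives both nonemptiness and [c <= M], the sign needed
   below to compare [(M - c)] times the two exponentials. *)
have Ec : E c.
  exists p, 0; split; first lra.
  by rewrite H0 Rabs_R0 Rmult_0_r Ropp_0 exp_0; ring.
have [M [Mub Mlub]] := completeness E Eb (ex_intro _ c Ec).
have Mc : c <= M by exact: Mub.
have ee s : exp (L * s) * exp (- (L * s)) = 1.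
  by rewrite -exp_plus -exp_0; congr exp; ring.
have HM q s : 0 <= s <= t -> Rabs (u q s) <= M * exp (L * s) - c.
  move=> Hs; have : (Rabs (u q s) + c) * exp (- (L * s)) <= M by apply: Mub; exists q, s.
  move=> H; have := Rmult_le_compat_r _ _ _ (Rlt_le _ _ (exp_pos (L * s))) H.
  have -> : (Rabs (u q s) + c) * exp (- (L * s)) * exp (L * s) =
    (Rabs (u q s) + c) * (exp (L * s) * exp (- (L * s))) by ring.
  by rewrite ee; lra.
have HM' q s : 0 <= s <= t -> Rabs (u q s) <= M * (exp (L * s) - 1).
  move=> Hs.
  apply: (is_derive_half_bound (u := u q) (du := du q)
     (G := fun r => M * (exp (L * r) - 1)) (dG := fun r => M * (L * exp (L * r)))).
  - lra.
  - by move=> r Hr; apply: Hu; lra.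
  - by move=> r Hr; auto_derive => //; ring.
  - move=> r Hr; have r0 : 0 <= r by lra.
    have := Hdu r (M * exp (L * r) - c) q r0 (fun q' => HM q' r ltac:(lra)); lra.
  - by rewrite H0 Rabs_R0 Rmult_0_r exp_0; lra.
have : M <= M - (M - c) * exp (- (L * t)).
  apply: Mlub => x [q [s [Hs ->]]].
  have H := HM' q s Hs.
  have es := exp_pos (- (L * s)).
  have H2 : exp (- (L * t)) <= exp (- (L * s)).
    apply: exp_le_mono.
    by have := Rmult_le_compat_l _ _ _ (Rlt_le _ _ L0) (proj2 Hs); lra.
  have H3 : (M - c) * exp (- (L * t)) <= (M - c) * exp (- (L * s)).
    by apply: Rmult_le_compat_l => //; lra.
  have : (Rabs (u q s) + c) * exp (- (L * s)) <=
         (M * (exp (L * s) - 1) + c) * exp (- (L * s)).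
    by apply: Rmult_le_compat_r; lra.
  have -> : (M * (exp (L * s) - 1) + c) * exp (- (L * s)) =
    M * (exp (L * s) * exp (- (L * s))) - (M - c) * exp (- (L * s)) by ring.
  by rewrite ee; lra.
have et := exp_pos (- (L * t)).
move=> HMM; have {}HMM : M <= c.
  case: (Rle_lt_dec M c) => // Mlt.
  have := Rmult_lt_0_compat (M - c) _ ltac:(lra) et; lra.
have := HM p t ltac:(lra); have := exp_pos (L * t).
have := Rmult_le_compat_r _ _ _ (Rlt_le _ _ (exp_pos (L * t))) HMM; lra.
Qed.

(** * A priori bounds for the Kuramoto models *)

Section Coupling.

Variables (N : nat) (kappa : R).
Hypotheses (N0 : (0 < N)%N) (kappa0 : 0 < kappa).

Lemma mean_le (f : 'I_N -> R) (M : R) : (forall j, Rabs (f j) <= M) ->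
  Rabs (kappa / INR N * \big[Rplus/0]_(j < N) f j) <= kappa * M.
Proof.
move=> H; have n0 : 0 < INR N by apply: lt_0_INR; apply/ltP.
rewrite Rabs_mult Rabs_pos_eq; last by apply: Rlt_le; exact: Rdiv_lt_0_compat.
have -> : kappa * M = kappa / INR N * (INR N * M) by field; lra.
apply: Rmult_le_compat_l; first by apply: Rlt_le; exact: Rdiv_lt_0_compat.
apply: Rle_trans (big_Rplus_abs _) _; rewrite -big_Rplus_const.
exact: big_Rplus_le.
Qed.

Lemma coupling_le (X : 'I_N -> R) (i : 'I_N) : Rabs (coupling kappa X i) <= kappa.
Proof.
rewrite -[X in _ <= X]Rmult_1_r; apply: mean_le => j.
by apply: Rabs_le; exact: SIN_bound.
Qed.

Lemma mean_sub_le (f g : 'I_N -> R) (M : R) : (forall j, Rabs (f j - g j) <= M) ->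
  Rabs (kappa / INR N * (\big[Rplus/0]_(j < N) f j)
        - kappa / INR N * (\big[Rplus/0]_(j < N) g j)) <= kappa * M.
Proof.
move=> H.
suff -> : kappa / INR N * (\big[Rplus/0]_(j < N) f j)
        - kappa / INR N * (\big[Rplus/0]_(j < N) g j)
        = kappa / INR N * \big[Rplus/0]_(j < N) (f j - g j) by exact: mean_le.
have -> : \big[Rplus/0]_(j < N) f j =
   \big[Rplus/0]_(j < N) g j + \big[Rplus/0]_(j < N) (f j - g j).
  by rewrite -big_split /=; apply: eq_bigr => j _; ring.
by ring.
Qed.

Lemma coupling_sub_le (X Y : 'I_N -> R) (i : 'I_N) (M : R) :
  (forall j, Rabs ((X j - X i) - (Y j - Y i)) <= M) ->
  Rabs (coupling kappa X i - coupling kappa Y i) <= kappa * M.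
Proof.
by move=> H; apply: mean_sub_le => j; apply: Rle_trans (Rabs_sin_sub _ _) _.
Qed.

Section Smooth.

Variables (n : nat) (th : 'I_N -> R -> R).
Hypothesis Hth : forall i, smooth n (th i).

Lemma smooth_sin_pair (i j : 'I_N) : smooth n (fun s => sin (th j s - th i s)).
Proof. by case: (smooth_sin_cos (smooth_minus (Hth j) (Hth i))). Qed.

Lemma smooth_coupling (i : 'I_N) : smooth n (fun s => coupling kappa (th^~ s) i).
Proof. by apply: smooth_scal; apply: smooth_sum => j; exact: smooth_sin_pair. Qed.

Lemma Derive_half_n_coupling (i : 'I_N) (t : R) : 0 <= t ->
  Derive_half_n n (fun s => coupling kappa (th^~ s) i) t = kappa / INR N *
    \big[Rplus/0]_(j < N) Derive_half_n n (fun s => sin (th j s - th i s)) t.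
Proof.
move=> t0; rewrite Derive_half_n_scal //.
  by rewrite Derive_half_n_sum // => j; exact: smooth_sin_pair.
by apply: smooth_sum => j; exact: smooth_sin_pair.
Qed.

Lemma Derive_half_n_coupling_le (i : 'I_N) (t M : R) : 0 <= t ->
  (forall j, Rabs (Derive_half_n n (fun s => sin (th j s - th i s)) t) <= M) ->
  Rabs (Derive_half_n n (fun s => coupling kappa (th^~ s) i) t) <= kappa * M.
Proof. by move=> t0 H; rewrite Derive_half_n_coupling //; exact: mean_le. Qed.

End Smooth.

Lemma Derive_half_n_coupling_sub_le (n : nat) (th th' : 'I_N -> R -> R)
    (i : 'I_N) (t M : R) :
  (forall i, smooth n (th i)) -> (forall i, smooth n (th' i)) -> 0 <= t ->
  (forall j, Rabs (Derive_half_n n (fun s => sin (th j s - th i s)) t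
                   - Derive_half_n n (fun s => sin (th' j s - th' i s)) t) <= M) ->
  Rabs (Derive_half_n n (fun s => coupling kappa (th^~ s) i) t
        - Derive_half_n n (fun s => coupling kappa (th'^~ s) i) t) <= kappa * M.
Proof. by move=> H H' t0 HM; rewrite !Derive_half_n_coupling //; exact: mean_sub_le. Qed.

End Coupling.

Lemma pow_le_mix (e x b : R) (k : nat) :
  0 <= e <= 1 -> 0 <= b <= x -> b ^ k <= mix e (x ^ k) (b ^ k).
Proof.
move=> He Hb; have H := pow_le_mono k Hb; rewrite /mix.
by have := Rmult_le_compat_l e _ _ (proj1 He) H; lra.
Qed.

(** * A priori bounds for the first-order model *)

Section FirstOrder.

Variables (N : nat) (kappa : R) (nu theta0 : 'I_N -> R) (p : 'I_N -> R -> R).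
Hypotheses (N0 : (0 < N)%N) (kappa0 : 0 < kappa).
Hypothesis Hp : first_order_kuramoto kappa nu theta0 p.

Let C i s := coupling kappa (p^~ s) i.

Lemma first_order_is_derive (i : 'I_N) (s : R) : 0 <= s ->
  is_derive_half (p i) s (nu i + C i s).
Proof.
by move=> s0; have [Hex <-] := proj2 Hp i s s0; exact: Derive_half_correct.
Qed.

Lemma first_order_smooth (n : nat) (i : 'I_N) : smooth n (p i).
Proof.
elim: n i => [//|n IH] i.
apply: (smooth_derive (df := fun s => nu i + C i s)); first exact: first_order_is_derive.
by apply: smooth_plus; [exact: smooth_const | exact: smooth_coupling].
Qed.

Lemma first_orderE (n : nat) (i : 'I_N) (s : R) : 0 <= s ->
  Derive_half_n n.+2 (p i) s = Derive_half_n n.+1 (C i) s.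
Proof.
move=> s0; have SC k : smooth k (C i) by apply: smooth_coupling => j; exact: first_order_smooth.
rewrite (Derive_half_nS_eq (df := fun s => nu i + C i s)) //.
- rewrite Derive_half_n_plus //; try exact: smooth_const.
  by rewrite Derive_half_nS_const //; ring.
- by move=> t t0; exact: first_order_is_derive.
- by apply: smooth_plus; [exact: smooth_const | exact: SC].
Qed.

(** The derivative of order [n + 2] of a phase is that of order [n + 1] of its coupling, and the
    composition bound for the latter needs phase differences up to order [n + 1] only. The pair
    costs [2 * kappa <= B], which supplies the missing power of [B]. *)
Lemma first_order_pair_le (B : R) : diam nu + 2 * kappa <= B ->
  forall n i j s, 0 <= s ->
  Rabs (Derive_half_n n.+1 (fun t => p j t - p i t) s) <= INR n`! * B ^ n.+1.
Proof.
move=> HB; have d0 := diam_ge0 nu N0; elim/ltn_ind => n IH i j s s0.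
have Sp := first_order_smooth.
rewrite Derive_half_n_minus //; try exact: Sp.
case: n IH => [|n] IH.
  rewrite /Derive_half_n /= (is_derive_half_unique s0 (first_order_is_derive j s0))
   (is_derive_half_unique s0 (first_order_is_derive i s0)).
  rewrite -[INR _]/1 Rmult_1_l Rmult_1_r; apply: Rle_trans HB.
  have -> : nu j + C j s - (nu i + C i s) = (nu j - nu i) + (C j s + - C i s) by ring.
  apply: Rle_trans (Rabs_triang _ _) _; apply: Rplus_le_compat; first exact: diam_ge.
  apply: Rle_trans (Rabs_triang _ _) _; rewrite Rabs_Ropp.
  have := coupling_le N0 kappa0 (p^~ s) i; have := coupling_le N0 kappa0 (p^~ s) j.
  by rewrite /C; lra.
rewrite !first_orderE //.
have HC k : Rabs (Derive_half_n n.+1 (C k) s) <= kappa * (INR (n.+1)`! * B ^ n.+1).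
  apply: Derive_half_n_coupling_le => // l.
  (* There is no initial layer here: weight [e := 0] reduces [mix] to its limit part. *)
  have [] := Derive_half_n_sin_cos_le (e := 0) (x := B) (b := B) ltac:(lra) ltac:(lra)
    s0 (smooth_minus (Sp n.+1 l) (Sp n.+1 k)) _ (leqnn n.+1).
    move=> k' kn; apply: Rle_trans (IH k' kn _ _ _ s0) _.
    by rewrite /mix; right; ring.
  by move=> H _; apply: Rle_trans H _; rewrite /mix; right; ring.
apply: Rle_trans (Rabs_triang _ _) _; rewrite Rabs_Ropp.
have := HC i; have := HC j; set F := INR _ * _ => H1 H2.
have F0 : 0 <= F by apply: Rmult_le_pos; [exact: pos_INR | apply: pow_le; lra].
have : 2 * kappa * F <= B * F by apply: Rmult_le_compat_r; lra.
have -> : INR (n.+1)`! * B ^ n.+2 = B * F by rewrite /F -!tech_pow_Rmult; ring.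
by lra.
Qed.

End FirstOrder.

(** * A priori bounds for the inertial model *)

Section Inertial.

Variables (N : nat) (m kappa : R) (nu theta0 omega0 : 'I_N -> R) (q : 'I_N -> R -> R).
Hypotheses (N0 : (0 < N)%N) (kappa0 : 0 < kappa) (m0 : 0 < m).
Hypothesis Hq : inertial_kuramoto m kappa nu theta0 omega0 q.

Let C i s := coupling kappa (q^~ s) i.

Lemma inertial_is_derive2 (i : 'I_N) (s : R) : 0 <= s ->
  is_derive_half (Derive_half (q i)) s (/ m * (nu i + C i s - Derive_half (q i) s)).
Proof.
move=> s0; have [_ [Hex]] := proj2 (proj2 Hq) i s s0.
rewrite /Derive_half_n /= -/(C i s) => E.
have -> : / m * (nu i + C i s - Derive_half (q i) s) = Derive_half (Derive_half (q i)) s.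
  by rewrite -E; field; lra.
exact: Derive_half_correct.
Qed.

Lemma inertial_smooth (n : nat) (i : 'I_N) : smooth n (q i).
Proof.
(* The velocity is carried along because the equation, solved for the acceleration, involves both
   phases and velocity. *)
suff : forall i, smooth n (q i) /\ smooth n (Derive_half (q i)) by move=> /(_ i) [].
elim: n => [//|n IH] {}i; split.
  split; last by case: (IH i).
  by move=> t t0; case: (proj2 (proj2 Hq) i t t0).
apply: (smooth_derive (df := fun s => / m * (nu i + C i s - Derive_half (q i) s))).
  by move=> t t0; exact: inertial_is_derive2.
apply: smooth_scal; apply: smooth_minus; last by case: (IH i).
apply: smooth_plus; first exact: smooth_const.
by apply: smooth_coupling => j; case: (IH j).
Qed.

Lemma inertialE (n : nat) (i : 'I_N) (s : R) : 0 <= s ->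
  m * Derive_half_n n.+3 (q i) s + Derive_half_n n.+2 (q i) s = Derive_half_n n.+1 (C i) s.
Proof.
move=> s0; have SC k : smooth k (C i) by apply: smooth_coupling => j; exact: inertial_smooth.
have Sw k : smooth k (Derive_half (q i)) by case: (inertial_smooth k.+1 i).
rewrite (Derive_half_nS n.+2 (q i)) (Derive_half_nS n.+1 (q i)).
rewrite (Derive_half_nS_eq (f := Derive_half (q i)) (n := n.+1)
  (df := fun s => / m * (nu i + C i s - Derive_half (q i) s))) //.
- rewrite Derive_half_n_scal ?Derive_half_n_minus ?Derive_half_n_plus ?Derive_half_nS_const //;
    repeat first [exact: smooth_const | exact: SC | exact: Sw | apply: smooth_minus | apply: smooth_plus].
  by field; lra.
- by move=> t t0; exact: inertial_is_derive2.
- by repeat first [exact: smooth_const | exact: SC | exact: Sw | apply: smooth_scal | apply: smooth_minus | apply: smooth_plus].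
Qed.

Lemma inertialE1 (i : 'I_N) (s : R) : 0 <= s ->
  m * Derive_half_n 2 (q i) s + Derive_half_n 1 (q i) s = nu i + C i s.
Proof. by move=> s0; case: (proj2 (proj2 Hq) i s s0) => _ [_]. Qed.

Lemma inertial_is_derive (n : nat) (i : 'I_N) (s : R) : 0 <= s ->
  is_derive_half (Derive_half_n n (q i)) s (Derive_half_n n.+1 (q i) s).
Proof. move=> s0; apply: is_derive_half_Derive_half_n => //; exact: inertial_smooth. Qed.

Lemma inertial_is_derive_pair (n : nat) (i j : 'I_N) (s : R) : 0 <= s ->
  is_derive_half (Derive_half_n n (fun t => q j t - q i t)) s
    (Derive_half_n n.+1 (fun t => q j t - q i t) s).
Proof.
move=> s0; apply: is_derive_half_Derive_half_n => //.
by apply: smooth_minus; exact: inertial_smooth.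
Qed.

Lemma coupling_pair_le (X : 'I_N -> R) (i j : 'I_N) :
  Rabs (coupling kappa X j - coupling kappa X i) <= 2 * kappa.
Proof.
apply: Rle_trans (Rabs_triang _ _) _; rewrite Rabs_Ropp.
by have := coupling_le N0 kappa0 X i; have := coupling_le N0 kappa0 X j; lra.
Qed.

Lemma exp_decay (t : R) : 0 <= t -> 0 <= exp (- t / m) <= 1.
Proof.
move=> t0; split; first exact: Rlt_le (exp_pos _).
rewrite -exp_0; apply: exp_le_mono.
by have := Rdiv_le_0_compat _ _ t0 m0; rewrite /Rdiv; lra.
Qed.

(* The value at [t] of the majorant is a convex combination of the ones of an
   initial layer (geometric of ratio [Q (1 + t / m)]) and of the limit (ratio [B]). *)
Lemma inertial_pair_le (B Q : R) : diam omega0 + diam nu + 2 * kappa <= B ->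
  B <= Q -> / m <= Q ->
  forall n i j t, 0 <= t ->
  Rabs (Derive_half_n n.+1 (fun s => q j s - q i s) t)
    <= INR n`! * mix (exp (- t / m)) ((Q * (1 + t / m)) ^ n.+1) (B ^ n.+1).
Proof.
move=> HB BQ mQ; have d0 := diam_ge0 nu N0; have d1 := diam_ge0 omega0 N0.
elim/ltn_ind => n IH i j t t0.
have Sq := inertial_smooth.
have Q0 : 0 <= Q by lra.
pose y := Derive_half_n n.+1 (fun s => q j s - q i s).
suff H : Rabs (y t) <= INR n`! * Q ^ n.+1 * (1 + t / m) ^ n.+1 * exp (- t / m)
      + INR n`! * B ^ n.+1 * (1 - exp (- t / m)).
  by apply: Rle_trans H _; rewrite /mix Rpow_mult_distr; right; ring.
have f0 : 0 <= INR n`! by exact: pos_INR.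
have e0 s : 0 < exp (- s / m) by exact: exp_pos.
have layer s : 0 <= s -> B <= Q * (1 + s / m).
  move=> s0; have := Rmult_le_pos _ _ Q0 (Rdiv_le_0_compat _ _ s0 m0); lra.
have HC n' l s : 0 <= s -> (n' <= n)%N ->
    Rabs (Derive_half_n n' (C l) s)
      <= kappa * (INR n'`! * mix (exp (- s / m)) ((Q * (1 + s / m)) ^ n') (B ^ n')).
  move=> s0 n'n.
  apply: Derive_half_n_coupling_le => // k.
  have := layer s s0.
  have := Derive_half_n_sin_cos_le (exp_decay s0) (x := Q * (1 + s / m)) (b := B) _
     s0 (smooth_minus (Sq n' k) (Sq n' l)) _ (leqnn n').
  move=> H H'; case: H => //; first lra.
  by move=> k' kn; apply: IH => //; exact: leq_trans kn n'n.
apply: (relaxation_bound (dy := Derive_half_n n.+2 (fun s => q j s - q i s)) m0 t0).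
- by apply: Rmult_le_pos => //; apply: pow_le; lra.
- by apply: Rmult_le_pos => //; apply: pow_le; lra.
- by move=> s Hs; apply: inertial_is_derive_pair; lra.
- rewrite /y Derive_half_n_minus //; try exact: Sq; try lra.
  have z0 := Rle_refl 0.
  case: n IH HC @y f0 => [|n] IH HC _ f0.
    rewrite /Derive_half_n /= !(proj1 (proj2 Hq)) -[INR _]/1.
    by have := diam_ge omega0 j i; lra.
  have im : 0 < / m by exact: Rinv_0_lt_compat.
  (* Initial derivatives come from the equation solved at time 0, at the cost of one factor
     [/ m <= Q] per order. The natural frequency survives only in the undifferentiated equation,
     that is for [n = 0]. *)
  have E k : Derive_half_n n.+2 (q k) 0 = / m *
      ((if n is 0%N then nu k else 0) + Derive_half_n n (C k) 0 - Derive_half_n n.+1 (q k) 0).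
    case: n {IH HC f0} => [|n]; first by rewrite -[Derive_half_n 0 (C k) 0]/(C k 0) -inertialE1 //; field; lra.
    by rewrite -inertialE //; field; lra.
  rewrite !E -Rmult_minus_distr_l Rabs_mult Rabs_pos_eq; last lra.
  have HCn := HC n _ 0 z0 (leqnSn n).
  have l1 : 0 / m = 0 by rewrite /Rdiv Rmult_0_l.
  have l2 : - 0 / m = 0 by rewrite Ropp_0.
  have E0 : forall k, mix (exp (- 0 / m)) ((Q * (1 + 0 / m)) ^ k) (B ^ k) = Q ^ k.
    by move=> k; rewrite l1 l2 exp_0 /mix Rplus_0_r Rmult_1_r; ring.
  have IHn := IH n (ltnSn n) i j 0 z0.
  rewrite Derive_half_n_minus // E0 in IHn; try exact: Sq.
  rewrite E0 in HCn.
  have tri a b c u v w : Rabs a <= u -> Rabs b <= v -> Rabs c <= w -> Rabs (a + b - c) <= u + v + w.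
    move=> *; apply: Rle_trans (Rabs_triang _ _) _; rewrite Rabs_Ropp.
    by have := Rabs_triang a b; lra.
  pose G := INR n`! * Q ^ n.
  have G0 : 0 <= G by apply: Rmult_le_pos; [exact: pos_INR | exact: pow_le].
  (* For [n = 0] the three terms add up to at most [B <= Q]. Afterwards coupling and previous
     derivative contribute at most [Q * G] each, and the factor [INR n.+1 >= 2] absorbs both. *)
  have Hnum : Rabs ((if n is 0%N then nu j - nu i else 0)
      + (Derive_half_n n (C j) 0 - Derive_half_n n (C i) 0)
      - (Derive_half_n n.+1 (q j) 0 - Derive_half_n n.+1 (q i) 0)) <=
      INR n.+1 * Q * G.
    case: n @G G0 IH HC E HCn IHn f0 => [|n] G G0 IH HC E HCn IHn f0.
      rewrite /G fact0 /= INR_1.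
      apply: (Rle_trans _ (diam nu + 2 * kappa + diam omega0)); last lra.
      apply: tri; [exact: diam_ge | exact: coupling_pair_le | ].
      by rewrite /Derive_half_n /= !(proj1 (proj2 Hq)); exact: diam_ge.
    apply: (Rle_trans _ (0 + 2 * kappa * G + Q * G)).
      apply: tri; first by rewrite Rabs_R0; exact: Rle_refl.
        apply: Rle_trans (Rabs_triang _ _) _; rewrite Rabs_Ropp.
        by have := HCn i; have := HCn j; rewrite -/G; lra.
      by apply: Rle_trans IHn _; rewrite /G /=; right; ring.
    have QG := Rmult_le_pos _ _ Q0 G0; have n1 := pos_INR n.
    have := Rmult_le_pos _ _ n1 QG.
    have : 2 * kappa * G <= Q * G by apply: Rmult_le_compat_r; lra.
    by rewrite !S_INR; lra.
  have -> : ((match n with 0%N => nu j | _.+1 => 0 end) + Derive_half_n n (C j) 0 - Derive_half_n n.+1 (q j) 0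
     - ((match n with 0%N => nu i | _.+1 => 0 end) + Derive_half_n n (C i) 0 - Derive_half_n n.+1 (q i) 0)) =
     ((if n is 0%N then nu j - nu i else 0)
      + (Derive_half_n n (C j) 0 - Derive_half_n n (C i) 0)
      - (Derive_half_n n.+1 (q j) 0 - Derive_half_n n.+1 (q i) 0)).
    by case: (n) => [|?]; ring.
  apply: Rle_trans (Rmult_le_compat _ _ _ _ _ _ mQ Hnum) _; [lra | exact: Rabs_pos | ].
  by rewrite INR_factS /G /=; right; ring.
- move=> s Hs; have s0 : 0 <= s by lra.
  rewrite /y !Derive_half_n_minus //; try exact: Sq.
  have es := exp_decay s0.
  case: n IH HC @y f0 => [|n] IH HC _ f0.
    have -> : m * (Derive_half_n 2 (q j) s - Derive_half_n 2 (q i) s) +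
      (Derive_half_n 1 (q j) s - Derive_half_n 1 (q i) s) =
      (nu j - nu i) + (C j s - C i s).
      by have := inertialE1 j s0; have := inertialE1 i s0; lra.
    apply: Rle_trans (Rabs_triang _ _) _.
    have := diam_ge nu j i; have : Rabs (C j s - C i s) <= 2 * kappa := coupling_pair_le (q^~ s) i j.
    rewrite fact0 INR_1 /=.
    have := Rmult_le_pos _ _ Q0 (proj1 es); lra.
  have -> : m * (Derive_half_n n.+3 (q j) s - Derive_half_n n.+3 (q i) s) +
      (Derive_half_n n.+2 (q j) s - Derive_half_n n.+2 (q i) s) =
      Derive_half_n n.+1 (C j) s - Derive_half_n n.+1 (C i) s.
    by have := inertialE n j s0; have := inertialE n i s0; lra.
  apply: Rle_trans (Rabs_triang _ _) _; rewrite Rabs_Ropp.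
  have Hi := HC n.+1 i s s0 (leqnn _); have Hj := HC n.+1 j s s0 (leqnn _).
  set F := INR (n.+1)`! in f0 Hi Hj *.
  have := Rplus_le_compat _ _ _ _ Hj Hi; set lhs := Rabs _ + Rabs _ => Hlhs.
  apply: Rle_trans Hlhs _; rewrite /mix Rpow_mult_distr /= -/F.
  have X0 : 0 <= F * (exp (- s / m) * (Q * Q ^ n * ((1 + s / m) * (1 + s / m) ^ n))).
    have sm := Rdiv_le_0_compat _ _ s0 m0.
    by repeat apply: Rmult_le_pos => //; try apply: pow_le; lra.
  have Y0 : 0 <= F * (B * B ^ n).
    by repeat apply: Rmult_le_pos => //; try apply: pow_le; lra.
  set X := F * _ in X0; set Y := F * _ in Y0.
  have eY : (1 - exp (- s / m)) * Y <= Y.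
    by have := Rmult_le_pos _ _ (proj1 es) Y0; lra.
  have -> : kappa * (F * (exp (- s / m) * (Q * Q ^ n * ((1 + s / m) * (1 + s / m) ^ n)) + (1 - exp (- s / m)) * (B * B ^ n))) +
     kappa * (F * (exp (- s / m) * (Q * Q ^ n * ((1 + s / m) * (1 + s / m) ^ n)) + (1 - exp (- s / m)) * (B * B ^ n))) =
     2 * kappa * X + 2 * kappa * ((1 - exp (- s / m)) * Y) by rewrite /X /Y; ring.
  have -> : INR n.+2 * (F * (Q * (Q * Q ^ n))) * ((1 + s / m) * (1 + s / m) ^ n) * exp (- s / m) +
    F * (B * (B * B ^ n)) = INR n.+2 * Q * X + B * Y by rewrite /X /Y; ring.
  have k2 : 0 <= 2 * kappa by lra.
  have := Rmult_le_compat_l _ _ _ k2 eY.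
  have : 2 * kappa * Y <= B * Y by apply: Rmult_le_compat_r; lra.
  have : 2 * kappa * X <= Q * X by apply: Rmult_le_compat_r; lra.
  have := Rmult_le_pos _ _ (pos_INR n) (Rmult_le_pos _ _ Q0 X0).
  have := Rmult_le_pos _ _ Q0 X0.
  by rewrite !S_INR; lra.
Qed.

End Inertial.

(** * Comparison of the two models *)

Section Comparison.

Variables (N : nat) (m kappa : R) (nu theta0 omega0 : 'I_N -> R) (p q : 'I_N -> R -> R).
Hypotheses (N0 : (0 < N)%N) (kappa0 : 0 < kappa) (m0 : 0 < m).
Hypothesis Hp : first_order_kuramoto kappa nu theta0 p.
Hypothesis Hq : inertial_kuramoto m kappa nu theta0 omega0 q.

Let slip i := omega0 i - nu i.
Let K := diam slip + 2 * kappa.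
Let Cp i s := coupling kappa (p^~ s) i.
Let Cq i s := coupling kappa (q^~ s) i.
Let del n i s := Derive_half_n n (q i) s - Derive_half_n n (p i) s.

Lemma diam_slip_le : diam slip <= diam omega0 + diam nu.
Proof.
have [i [j ->]] := diam_attained slip N0.
have -> : slip i - slip j = (omega0 i - omega0 j) + - (nu i - nu j) by rewrite /slip; ring.
apply: Rle_trans (Rabs_triang _ _) _; rewrite Rabs_Ropp.
by have := diam_ge omega0 i j; have := diam_ge nu i j; lra.
Qed.

Lemma K_pos : 0 < K.
Proof. by rewrite /K; have := diam_ge0 slip N0; lra. Qed.

Lemma del_is_derive (n : nat) (i : 'I_N) (s : R) : 0 <= s ->
  is_derive_half (del n i) s (del n.+1 i s).
Proof.
move=> s0; apply: is_derive_half_minus => //; first exact: (inertial_is_derive m0 Hq).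
by apply: is_derive_half_Derive_half_n => //; exact: (first_order_smooth Hp).
Qed.

Lemma first_orderE1 (i : 'I_N) (s : R) : 0 <= s ->
  Derive_half_n 1 (p i) s = nu i + Cp i s.
Proof. by move=> s0; apply: (is_derive_half_unique s0); exact: (first_order_is_derive Hp). Qed.

(** The first-order solution satisfies the inertial equation up to [m] times its second derivative,
    that is [m] times the derivative of its coupling. This residual is the last term. *)
Lemma delE (n : nat) (i : 'I_N) (s : R) : 0 <= s ->
  m * del n.+2 i s + del n.+1 i s =
  (Derive_half_n n (Cq i) s - Derive_half_n n (Cp i) s) - m * Derive_half_n n.+1 (Cp i) s.
Proof.
move=> s0; rewrite /del (first_orderE Hp) // -/(Cp i).
case: n => [|n].
  have := inertialE1 Hq i s0; rewrite first_orderE1 // => H.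
  rewrite -[Derive_half_n 0 (Cq i) s]/(coupling kappa (q^~ s) i).
  by rewrite -[Derive_half_n 0 (Cp i) s]/(Cp i s); lra.
by rewrite (first_orderE Hp) // -/(Cp i); have := inertialE m0 Hq n i s0; rewrite -/(Cq i); lra.
Qed.

Lemma velocity_init (i : 'I_N) : Derive_half_n 1 (q i) 0 = omega0 i.
Proof. by case: Hq => _ []. Qed.

(** Measured from [omega0], velocities start at 0, so relaxation produces no initial part; the
    forcing becomes [nu - omega0] plus the coupling, of oscillation at most [K]. *)
Lemma velocity_pair_le (i j : 'I_N) (t : R) : 0 <= t ->
  Rabs ((Derive_half_n 1 (q j) t - omega0 j) - (Derive_half_n 1 (q i) t - omega0 i))
    <= K * (1 - exp (- t / m)).
Proof.
move=> t0; have z0 := Rle_refl 0; have Kp := K_pos.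
have := relaxation_bound0 (a := 0) (b := K)
  (y := fun s => (Derive_half_n 1 (q j) s - omega0 j) - (Derive_half_n 1 (q i) s - omega0 i))
  (dy := fun s => (Derive_half_n 2 (q j) s - 0) - (Derive_half_n 2 (q i) s - 0)) m0 t0 z0.
rewrite Rmult_0_l Rplus_0_l; apply; first lra.
- move=> s [s0 _]; apply: is_derive_half_minus => //; apply: is_derive_half_minus => //;
    first [exact: (inertial_is_derive m0 Hq)
          | by apply: is_derive_is_derive_half => //; exact: is_derive_const].
- rewrite !velocity_init // !Rminus_diag Rabs_R0; lra.
- move=> s [s0 _].
  have := inertialE1 Hq i s0; have := inertialE1 Hq j s0.
  set X := coupling _ _ j; set Y := coupling _ _ i => E1 E2.
  have -> : m * (Derive_half_n 2 (q j) s - 0 - (Derive_half_n 2 (q i) s - 0)) +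
    (Derive_half_n 1 (q j) s - omega0 j - (Derive_half_n 1 (q i) s - omega0 i)) =
    - (slip j - slip i) + (X - Y) by rewrite /slip; lra.
  apply: Rle_trans (Rabs_triang _ _) _; rewrite Rabs_Ropp.
  have := diam_ge slip j i; have := coupling_pair_le N0 kappa0 (q^~ s) i j.
  by rewrite -/X -/Y /K; lra.
Qed.

Lemma velocity_le (i : 'I_N) (t : R) : 0 <= t ->
  Rabs (Derive_half_n 1 (q i) t - omega0 i)
    <= (Rabs ((vmax slip + vmin slip) / 2) + K / 2) * (1 - exp (- t / m)).
Proof.
move=> t0; have z0 := Rle_refl 0; have Kp := K_pos.
have := relaxation_bound0 (a := 0) (b := Rabs ((vmax slip + vmin slip) / 2) + K / 2)
  (y := fun s => Derive_half_n 1 (q i) s - omega0 i)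
  (dy := fun s => Derive_half_n 2 (q i) s - 0) m0 t0 z0.
rewrite Rmult_0_l Rplus_0_l; apply.
- by have := Rabs_pos ((vmax slip + vmin slip) / 2); lra.
- move=> s [s0 _]; apply: is_derive_half_minus => //; first exact: (inertial_is_derive m0 Hq).
  by apply: is_derive_is_derive_half => //; exact: is_derive_const.
- rewrite !velocity_init // !Rminus_diag Rabs_R0; lra.
- move=> s [s0 _].
  have := inertialE1 Hq i s0; set Y := coupling _ _ i => E2.
  have -> : m * (Derive_half_n 2 (q i) s - 0) +
    (Derive_half_n 1 (q i) s - omega0 i) = - slip i + Y by rewrite /slip; lra.
  apply: Rle_trans (Rabs_triang _ _) _; rewrite Rabs_Ropp.
  have := Rabs_le_midrange slip i; have := coupling_le N0 kappa0 (q^~ s) i.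
  by rewrite -/Y /K; lra.
Qed.

Lemma coupling_del_le (i : 'I_N) (s M : R) :
  (forall j, Rabs (del 0 j s - del 0 i s) <= M) -> Rabs (Cq i s - Cp i s) <= kappa * M.
Proof.
move=> H; apply: coupling_sub_le => // j.
by apply: Rle_trans (H j); right; congr Rabs; rewrite /del /=; ring.
Qed.

(* [delta + m (theta_m' - omega0)] has derivative [C(theta_m) - C(theta_0)], whose
   oscillation is at most [2 kappa] times that of [delta]. *)
Lemma del0_pair_le (i j : 'I_N) (t : R) : 0 <= t ->
  Rabs (del 0 j t - del 0 i t) <= m * K * (exp (2 * kappa * t) - exp (- t / m)).
Proof.
move=> t0; have Kp := K_pos; have mK : 0 < m * K by exact: Rmult_lt_0_compat.
pose y i s := del 0 i s + m * (Derive_half_n 1 (q i) s - omega0 i).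
have Hdel a b s : 0 <= s -> Rabs (del 0 a s - del 0 b s) <=
    Rabs (y a s - y b s) + m * K * (1 - exp (- s / m)).
  move=> s0; have -> : del 0 a s - del 0 b s = (y a s - y b s) +
    - (m * ((Derive_half_n 1 (q a) s - omega0 a) - (Derive_half_n 1 (q b) s - omega0 b))).
    by rewrite /y; ring.
  apply: Rle_trans (Rabs_triang _ _) _; rewrite Rabs_Ropp Rabs_mult (Rabs_pos_eq m); last lra.
  have := Rmult_le_compat_l m _ _ (Rlt_le _ _ m0) (velocity_pair_le b a s0); lra.
have dy a s : 0 <= s -> is_derive_half (y a) s (Cq a s - Cp a s).
  move=> s0; have -> : Cq a s - Cp a s =
     del 1 a s + m * (Derive_half_n 2 (q a) s - 0).
    have := inertialE1 Hq a s0; have := first_orderE1 a s0.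
    by rewrite /del -/(Cq a s); lra.
  apply: is_derive_half_plus => //; first exact: del_is_derive.
  apply: is_derive_half_scal => //; apply: is_derive_half_minus => //.
    exact: (inertial_is_derive m0 Hq).
  by apply: is_derive_is_derive_half => //; exact: is_derive_const.
have k2 : 0 < 2 * kappa by lra.
(* Gronwall's inequality runs over ordered pairs with [c = m * K] and [L = 2 * kappa]. Its [-1]
   cancels against the [1] in the velocity correction, and the remaining [- exp (- t / m)] later
   makes the estimate strict. *)
have := gronwall_family (I := ('I_N * 'I_N)%type) (u := fun ab s => y ab.2 s - y ab.1 s)
  (du := fun ab s => (Cq ab.2 s - Cp ab.2 s) - (Cq ab.1 s - Cp ab.1 s)) mK k2 _ _ _ (i, j) t0.
move=> /= H; have {}H : Rabs (y j t - y i t) <= m * K * (exp (2 * kappa * t) - 1).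
  apply: H.
  - by move=> ab s s0; apply: is_derive_half_minus => //; exact: dy.
  - move=> ab; rewrite /y !velocity_init /del /=.
    by rewrite !(proj1 Hq) !(proj1 Hp); ring.
  - move=> s M [a b] s0 HM /=.
    have es := exp_pos (- s / m).
    have HM' c d : Rabs (del 0 c s - del 0 d s) <= M + m * K.
      have := Hdel c d s s0; have := HM (d, c) => /=.
      by have := Rmult_lt_0_compat _ _ mK es; lra.
    apply: Rle_trans (Rabs_triang _ _) _; rewrite Rabs_Ropp.
    have := coupling_del_le (fun c => HM' c a); have := coupling_del_le (fun c => HM' c b).
    lra.
by have := Hdel j i t t0; lra.
Qed.

Lemma exp2k_mono (s t : R) : s <= t -> exp (2 * kappa * s) <= exp (2 * kappa * t).
Proof. by move=> H; apply: exp_le_mono; apply: Rmult_le_compat_l; lra. Qed.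

(** Evaluating the exponential at the final time makes the bound constant on [[0, t]], as required
    of the forcing in the relaxation lemmas. *)
Lemma del0_pair_le_exp (i j : 'I_N) (s t : R) : 0 <= s <= t ->
  Rabs (del 0 j s - del 0 i s) <= m * K * exp (2 * kappa * t).
Proof.
move=> [s0 st]; apply: Rle_trans (del0_pair_le i j s0) _.
apply: Rmult_le_compat_l; first by apply: Rmult_le_pos; have := K_pos; lra.
have := exp_pos (- s / m); have := exp2k_mono st; lra.
Qed.

(** The same auxiliary function as for pairs is integrated for one index. Its derivative is at most
    [kappa] times the pair bound, so no second Gronwall argument is needed; integrating
    [kappa * exp (2 * kappa * s)] produces the factor one half. *)
Lemma del0_le (i : 'I_N) (t : R) : 0 <= t ->
  Rabs (del 0 i t) <=
    m * ((Rabs ((vmax slip + vmin slip) / 2) + K / 2) * (1 - exp (- t / m)))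
    + m * K / 2 * (exp (2 * kappa * t) - 1).
Proof.
move=> t0; pose y s := del 0 i s + m * (Derive_half_n 1 (q i) s - omega0 i).
have mK : 0 < m * K by apply: Rmult_lt_0_compat => //; exact: K_pos.
have -> : del 0 i t = - (m * (Derive_half_n 1 (q i) t - omega0 i)) + y t by rewrite /y; ring.
apply: Rle_trans (Rabs_triang _ _) _; rewrite Rabs_Ropp Rabs_mult (Rabs_pos_eq m); last lra.
apply: Rplus_le_compat.
  by apply: Rmult_le_compat_l; [lra | exact: velocity_le].
apply: (is_derive_half_bound (u := y) (du := fun s => Cq i s - Cp i s)
  (G := fun s => m * K / 2 * (exp (2 * kappa * s) - 1))
  (dG := fun s => m * K / 2 * (2 * kappa * exp (2 * kappa * s)))) => //.
- move=> s [s0 _]; have -> : Cq i s - Cp i s =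
     del 1 i s + m * (Derive_half_n 2 (q i) s - 0).
    have := inertialE1 Hq i s0; have := first_orderE1 i s0.
    by rewrite /del -/(Cq i s); lra.
  apply: is_derive_half_plus => //; first exact: del_is_derive.
  apply: is_derive_half_scal => //; apply: is_derive_half_minus => //.
    exact: (inertial_is_derive m0 Hq).
  by apply: is_derive_is_derive_half => //; exact: is_derive_const.
- by move=> s _; auto_derive => //; field.
- move=> s [s0 _].
  have := coupling_del_le (fun c => del0_pair_le_exp i c (conj s0 (Rle_refl s))); lra.
- rewrite /y velocity_init /del /= (proj1 Hq) (proj1 Hp).
  by rewrite !Rminus_diag !Rmult_0_r Rplus_0_l Rabs_R0 exp_0; lra.
Qed.

Lemma first_order_coupling_derive_le (B : R) (n : nat) (i : 'I_N) (s : R) :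
  diam nu + 2 * kappa <= B -> 0 <= s ->
  Rabs (Derive_half_n n (Cp i) s) <= kappa * (INR n`! * B ^ n).
Proof.
move=> HB s0; have d0 := diam_ge0 nu N0.
have Sp := first_order_smooth Hp.
apply: Derive_half_n_coupling_le => // l.
have [] := Derive_half_n_sin_cos_le (e := 0) (x := B) (b := B) ltac:(lra) ltac:(lra)
    s0 (smooth_minus (Sp n l) (Sp n i)) _ (leqnn n).
  move=> k' kn; apply: Rle_trans (first_order_pair_le N0 kappa0 Hp HB _ _ _ s0) _.
  by rewrite /mix; right; ring.
by move=> H _; apply: Rle_trans H _; rewrite /mix; right; ring.
Qed.

Lemma del1_init (i : 'I_N) : del 1 i 0 = slip i - Cp i 0.
Proof.
by rewrite /del velocity_init first_orderE1 ?/slip; [ring | lra].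
Qed.

Lemma del1_rhs_le (i : 'I_N) (s t : R) : 0 <= s <= t ->
  Rabs (m * del 2 i s + del 1 i s)
    <= m * kappa * (diam nu + 2 * kappa) + m * kappa * K * exp (2 * kappa * t).
Proof.
move=> [s0 st]; rewrite delE //.
apply: Rle_trans (Rabs_triang _ _) _; rewrite Rabs_Ropp Rabs_mult (Rabs_pos_eq m); last lra.
have H1 : Rabs (Cq i s - Cp i s) <= _ :=
  coupling_del_le (fun c => del0_pair_le_exp i c (conj s0 st)).
have := first_order_coupling_derive_le 1 i (Rle_refl _) s0.
rewrite -[INR _]/1 Rmult_1_l pow_1 => H2.
have := Rmult_le_compat_l m _ _ (Rlt_le _ _ m0) H2.
rewrite -[Derive_half_n 0 (Cq i) s]/(Cq i s) -[Derive_half_n 0 (Cp i) s]/(Cp i s); lra.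
Qed.

Lemma del1_le (i : 'I_N) (t : R) : 0 <= t ->
  Rabs (del 1 i t) <= (norm_inf slip + kappa) * exp (- t / m)
    + (m * kappa * (diam nu + 2 * kappa) + m * kappa * K * exp (2 * kappa * t))
      * (1 - exp (- t / m)).
Proof.
move=> t0; have Kp := K_pos; have d0 := diam_ge0 nu N0.
have n0 := norm_inf_ge0 slip N0; have et := exp_pos (2 * kappa * t).
have mk : 0 < m * kappa by exact: Rmult_lt_0_compat.
have b0 : 0 <= m * kappa * (diam nu + 2 * kappa) + m * kappa * K * exp (2 * kappa * t).
  by apply: Rplus_le_le_0_compat; repeat apply: Rmult_le_pos; lra.
have a0 : 0 <= norm_inf slip + kappa by lra.
apply: (relaxation_bound0 (dy := del 2 i)) => //.
- by move=> s [s0 _]; exact: del_is_derive.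
- rewrite del1_init; apply: Rle_trans (Rabs_triang _ _) _; rewrite Rabs_Ropp.
  by apply: Rplus_le_compat; [exact: norm_inf_ge | exact: coupling_le].
- by move=> s Hs; exact: del1_rhs_le.
Qed.

Lemma del1_pair_le (i j : 'I_N) (t : R) : 0 <= t ->
  Rabs (del 1 j t - del 1 i t) <= K * exp (- t / m)
    + 2 * (m * kappa * (diam nu + 2 * kappa) + m * kappa * K * exp (2 * kappa * t))
      * (1 - exp (- t / m)).
Proof.
move=> t0; have Kp := K_pos; have d0 := diam_ge0 nu N0; have et := exp_pos (2 * kappa * t).
have mk : 0 < m * kappa by exact: Rmult_lt_0_compat.
have b0 : 0 <= 2 * (m * kappa * (diam nu + 2 * kappa) + m * kappa * K * exp (2 * kappa * t)).
  apply: Rmult_le_pos; first lra.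
  by apply: Rplus_le_le_0_compat; repeat apply: Rmult_le_pos; lra.
apply: (relaxation_bound0 (y := fun s => del 1 j s - del 1 i s)
  (dy := fun s => del 2 j s - del 2 i s)) => //; first lra.
- by move=> s [s0 _]; apply: is_derive_half_minus => //; exact: del_is_derive.
- rewrite !del1_init.
  have -> : slip j - Cp j 0 - (slip i - Cp i 0) = (slip j - slip i) + - (Cp j 0 - Cp i 0) by ring.
  apply: Rle_trans (Rabs_triang _ _) _; rewrite Rabs_Ropp.
  by apply: Rplus_le_compat; [exact: diam_ge | exact: coupling_pair_le].
- move=> s Hs.
  have -> : m * (del 2 j s - del 2 i s) + (del 1 j s - del 1 i s) =
    (m * del 2 j s + del 1 j s) + - (m * del 2 i s + del 1 i s) by ring.
  apply: Rle_trans (Rabs_triang _ _) _; rewrite Rabs_Ropp.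
  by have := del1_rhs_le i Hs; have := del1_rhs_le j Hs; lra.
Qed.

Lemma first_order_coupling_derive2_le (B : R) (i : 'I_N) (s : R) :
  diam nu + 2 * kappa <= B -> 0 <= s ->
  Rabs (Derive_half_n 2 (Cp i) s) <= kappa * (3 / 2 * B ^ 2).
Proof.
move=> HB s0; have d0 := diam_ge0 nu N0; have Sp := first_order_smooth Hp.
apply: Derive_half_n_coupling_le => // l.
pose phi s := p l s - p i s.
have Sphi n : smooth n phi by exact: smooth_minus.
have H1 := first_order_pair_le N0 kappa0 Hp HB 0 i l s0.
have H2 := first_order_pair_le N0 kappa0 Hp HB 1 i l s0.
rewrite -[INR _]/1 Rmult_1_l -/phi in H1; rewrite -[INR _]/1 Rmult_1_l -/phi in H2.
have Ssc := smooth_sin_cos (Sphi 1%N).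
have E : Derive_half_n 2 (fun s => sin (phi s)) s = - sin (phi s) * (Derive_half_n 1 phi s * Derive_half_n 1 phi s)
     + cos (phi s) * Derive_half_n 2 phi s.
  rewrite (Derive_half_nS_eq (n := 1) (df := fun s => cos (phi s) * Derive_half_n 1 phi s)) //.
  - apply: (is_derive_half_unique s0).
    rewrite -Rmult_assoc; apply: is_derive_half_mult => //.
      by apply: is_derive_half_cos => //; exact: (smooth_is_derive s0 (Sphi 1%N)).
    exact: (is_derive_half_Derive_half_n s0 (Sphi 2%N)).
  - by move=> r r0; apply: is_derive_half_sin => //; exact: (smooth_is_derive r0 (Sphi 1%N)).
  - by apply: smooth_mult; [case: Ssc | case: (Sphi 2%N)].
rewrite -/phi E.
have {}H1 : Rabs (Derive_half_n 1 phi s * Derive_half_n 1 phi s) <= B ^ 2.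
  rewrite Rabs_mult /= Rmult_1_r; rewrite /= Rmult_1_r in H1.
  by apply: Rmult_le_compat => //; exact: Rabs_pos.
move: H1 H2; set u := _ * Derive_half_n 1 phi s; set v := Derive_half_n 2 phi s.
set b := B ^ 2; move=> /Rabs_le_between H1 /Rabs_le_between H2.
have := sin2_cos2 (phi s); rewrite /Rsqr; set c := cos _; set w := sin _ => H.
have b0 : 0 <= b by lra.
(* Cauchy-Schwarz, and [sqrt 2 <= 3 / 2] *)
have X : (- w * u + c * v) ^ 2 <= 2 * b ^ 2.
  have u2 : u ^ 2 <= b ^ 2 by nra.
  have v2 : v ^ 2 <= b ^ 2 by nra.
  have : (- w * u + c * v) ^ 2 + (w * v + c * u) ^ 2 = (w * w + c * c) * (u ^ 2 + v ^ 2) by ring.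
  by rewrite H; have := pow2_ge_0 (w * v + c * u); lra.
by apply: Rabs_le; split; nra.
Qed.

(** * Derivatives of the difference of arbitrary order *)

Section HigherOrder.

Let B := diam omega0 + diam nu + 2 * kappa.
Let Q := B + 9 / (8 * m).
Let eps := m * kappa.

Variable t : R.
Hypothesis t0 : 0 <= t.
Let T := exp (2 * kappa * t).

(* Bounds on the Taylor coefficients of the phase differences of [delta], in units
   of [Q (1 + s / m)] in the initial layer and of [B] in the limit part. *)
Let top k := match k with
  | 0%N => m * B * T
  | 1%N => 1 + 4 * eps * T
  | _ => 2 / INR k + 3 / 2 * INR k.+1 * eps * T
  end.
Let bot k := match k with
  | 0%N => m * B * T
  | 1%N => 4 * eps * T
  | _ => 3 / 2 * INR k.+1 * eps * T
  end.

Lemma eps_pos : 0 < eps. Proof. exact: Rmult_lt_0_compat. Qed.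

Lemma T_ge1 : 1 <= T.
Proof. by rewrite /T -exp_0; apply: exp_le_mono; nonneg. Qed.

Lemma two_kappa_le_B : 0 < 2 * kappa <= B.
Proof. by rewrite /B; have := diam_ge0 nu N0; have := diam_ge0 omega0 N0; lra. Qed.

Lemma invm_Q : / m <= 8 / 9 * Q.
Proof.
rewrite /Q; have := two_kappa_le_B.
have -> : 9 / (8 * m) = 9 / 8 * / m by field; lra.
lra.
Qed.

Lemma B_le_Q : B <= Q.
Proof.
have : 0 < 9 / (8 * m) by apply: Rdiv_lt_0_compat; lra.
by rewrite /Q; lra.
Qed.

(** Since [kappa = eps * / m], the layer ratio can trade a bare [kappa] for the small factor [eps].
    This is how the entries of [top] without [eps] are absorbed in the estimate of a single
    phase. *)
Lemma kappa_le_Q : kappa <= 8 / 9 * eps * Q.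
Proof.
have := Rmult_le_compat_l eps _ _ (Rlt_le _ _ eps_pos) invm_Q.
have -> : eps * / m = kappa by rewrite /eps; field; lra.
lra.
Qed.

Lemma K_le_B : K <= B.
Proof. by rewrite /K /B; have := diam_slip_le; lra. Qed.

Lemma bot_le_top (k : nat) : 0 <= bot k <= top k.
Proof.
have e0 := eps_pos; have T1 := T_ge1; have B2 := two_kappa_le_B.
have eT : 0 < eps * T by apply: Rmult_lt_0_compat; lra.
case: k => [|[|k]] /=.
- by split; [nonneg | lra].
- lra.
have kp := pos_INR k; rewrite !S_INR; split.
  by nonneg.
have : 0 < 2 / (INR k + 1 + 1) by apply: Rdiv_lt_0_compat; lra.
lra.
Qed.

Lemma sum_bot (n : nat) : \big[Rplus/0]_(l < n.+2) bot l =
  m * B * T + eps * T * (1 + 3 / 4 * (INR n + 1) * (INR n + 4)).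
Proof.
elim: n => [|n IH]; first by rewrite !big_ord_recr big_ord0 /= -[INR 0]/0; field.
by rewrite big_ord_recr IH /= !S_INR; field.
Qed.

Lemma sum_top (n : nat) : \big[Rplus/0]_(l < n.+2) top l <=
  m * B * T + (INR n + 1) + eps * T * (1 + 3 / 4 * (INR n + 1) * (INR n + 4)).
Proof.
elim: n => [|n IH]; first by rewrite !big_ord_recr big_ord0 /= -[INR 0]/0; right; field.
rewrite big_ord_recr /= !S_INR; move: IH; set G := \big[_/_]_(_ < _) _.
have n0 := pos_INR n; have : 2 / (INR n + 1 + 1) <= 1.
  by apply/Rle_div_l; lra.
by lra.
Qed.

Let x s := Q * (1 + s / m).

Lemma B_le_x (s : R) : 0 <= s -> 0 <= B <= x s /\ Q <= x s.
Proof.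
move=> s0; have BQ := B_le_Q; have B2 := two_kappa_le_B.
have := Rmult_le_pos Q _ ltac:(lra) (Rdiv_le_0_compat _ _ s0 m0).
by rewrite /x; lra.
Qed.

(** The factor of [kappa * B ^ n.+2] in the bound on the coupling's derivative of order [n + 2]; at
    [n = 0] the value [3 / 2] replaces [2!]. *)
Let Z n := if n is 0%N then 3 / 2 else INR (n.+2)`!.

Lemma inertial_pair_le_mix (n : nat) (i j : 'I_N) (s : R) : 0 <= s ->
  Rabs (Derive_half_n n.+1 (fun r => q j r - q i r) s)
    <= INR n`! * mix (exp (- s / m)) (x s ^ n.+1) (B ^ n.+1).
Proof.
move=> s0; have := invm_Q; have BQ := B_le_Q; have B2 := two_kappa_le_B => mQ.
by apply: (inertial_pair_le N0 kappa0 m0 Hq _ BQ); [exact: Rle_refl | lra |].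
Qed.

(** A deliberate weakening: the comparison of sines needs one common majorant for the phases of both
    models. *)
Lemma first_order_pair_le_mix (n : nat) (i j : 'I_N) (s : R) : 0 <= s ->
  Rabs (Derive_half_n n.+1 (fun r => p j r - p i r) s)
    <= INR n`! * mix (exp (- s / m)) (x s ^ n.+1) (B ^ n.+1).
Proof.
move=> s0; have HB : diam nu + 2 * kappa <= B.
  by rewrite /B; have := diam_ge0 omega0 N0; lra.
apply: Rle_trans (first_order_pair_le N0 kappa0 Hp HB _ _ _ s0) _.
apply: Rmult_le_compat_l; first exact: pos_INR.
by apply: pow_le_mix; [exact: exp_decay | case: (B_le_x s0)].
Qed.

Lemma del_rhs_le (n : nat) (i : 'I_N) (s : R) : 0 <= s ->
  (forall k, (k <= n.+1)%N -> forall i j, Rabs (del k j s - del k i s) <=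
     INR k`! * mix (exp (- s / m)) (top k * x s ^ k) (bot k * B ^ k)) ->
  Rabs (m * del n.+3 i s + del n.+2 i s) <= kappa *
    (INR (n.+1)`! * mix (exp (- s / m)) ((\big[Rplus/0]_(l < n.+2) top l) * x s ^ n.+1)
         ((\big[Rplus/0]_(l < n.+2) bot l) * B ^ n.+1) + m * (Z n * B ^ n.+2)).
Proof.
move=> s0 IH; rewrite delE //.
have Sp := first_order_smooth Hp; have Sq := inertial_smooth m0 Hq.
have HB : diam nu + 2 * kappa <= B.
  by rewrite /B; have := diam_ge0 omega0 N0; lra.
rewrite Rmult_plus_distr_l; apply: Rle_trans (Rabs_triang _ _) _; apply: Rplus_le_compat.
  apply: Derive_half_n_coupling_sub_le => // l.
  have [] // := Derive_half_n_sin_cos_sub_le (exp_decay m0 s0) (proj1 (B_le_x s0)) s0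
    (smooth_minus (Sq n.+1 l) (Sq n.+1 i)) (smooth_minus (Sp n.+1 l) (Sp n.+1 i))
    bot_le_top _ _ _ (leqnn n.+1).
  - by move=> k _; exact: inertial_pair_le_mix.
  - by move=> k _; exact: first_order_pair_le_mix.
  - move=> k kn; rewrite !Derive_half_n_minus //; try exact: Sp; try exact: Sq.
    by apply: Rle_trans (IH k kn i l); right; congr Rabs; rewrite /del; ring.
rewrite Rabs_Ropp Rabs_mult (Rabs_pos_eq m); last lra.
have -> : kappa * (m * (Z n * B ^ n.+2)) = m * (kappa * (Z n * B ^ n.+2)) by ring.
apply: Rmult_le_compat_l; first lra.
case: n {IH} => [|n]; first exact: first_order_coupling_derive2_le.
exact: first_order_coupling_derive_le.
Qed.

(** The limit part of the forcing of a pair must not exceed the limit bound claimed at order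
    [n + 2]; the induction for [del_pair_le] closes through this inequality and [top_rate]. *)
Lemma bottom_rate (n : nat) :
  2 * kappa * (INR (n.+1)`! * ((\big[Rplus/0]_(l < n.+2) bot l) * B ^ n.+1) + m * (Z n * B ^ n.+2))
    <= INR (n.+2)`! * (bot n.+2 * B ^ n.+2).
Proof.
rewrite sum_bot (INR_factS n.+1); have e0 := eps_pos; have T1 := T_ge1; have B2 := two_kappa_le_B.
set b := B ^ n.+1; have b0 : 0 <= b by apply: pow_le; lra.
have -> : B ^ n.+2 = B * b by [].
have f1 := fact_ge1 n.+1; set f := INR (n.+1)`! in f1 *.
have n0 := pos_INR n.
have -> : bot n.+2 = 3 / 2 * INR n.+3 * eps * T by [].
rewrite !S_INR.
set A := 1 + 3 / 4 * (INR n + 1) * (INR n + 4).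
have A0 : 0 <= A by rewrite /A; have := Rmult_le_pos (INR n + 1) (INR n + 4) ltac:(lra) ltac:(lra); lra.
have -> : 2 * kappa * (f * ((m * B * T + eps * T * A) * b) + m * (Z n * (B * b))) =
  b * (eps * (B * (f * (2 * T) + 2 * Z n)) + eps * ((2 * kappa) * (f * (T * A)))).
  by rewrite /eps; ring.
have -> : (INR n + 1 + 1) * f * (3 / 2 * (INR n + 1 + 1 + 1) * eps * T * (B * b)) =
  b * (eps * (B * (f * (T * (3 / 2 * (INR n + 2) * (INR n + 3)))))) by ring.
apply: Rmult_le_compat_l => //; rewrite -Rmult_plus_distr_l.
apply: Rmult_le_compat_l; first lra.
have fTA : 0 <= f * (T * A) by nonneg.
have : 2 * kappa * (f * (T * A)) <= B * (f * (T * A)) by apply: Rmult_le_compat_r; lra.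
suff : f * (2 * T) + 2 * Z n + f * (T * A) <= f * (T * (3 / 2 * (INR n + 2) * (INR n + 3))).
  by move=> H; have := Rmult_le_compat_l B _ _ ltac:(lra) H; lra.
have Tf : f <= f * T.
  by rewrite -[X in X <= _]Rmult_1_r; apply: Rmult_le_compat_l; lra.
case: n @b b0 @f f1 n0 @A A0 fTA Tf => [|n] b b0 f f1 n0 A A0 fTA Tf.
  (* The claim is [6 T + 3 <= 9 T], an equality at [T = 1]. With [2] in place of [3 / 2] in [Z] it
     would read [6 T + 4 <= 9 T] and fail there. *)
  by rewrite /A /Z -[INR 0]/0; rewrite -[f]/1 in Tf *; lra.
have -> : Z n.+1 = (INR n.+1 + 2) * f by rewrite /Z INR_factS -/f !S_INR; ring.
have fT : 0 <= f * T by lra.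
suff : 2 * (INR n.+1 + 2) * (f * T) <= (3 / 2 * (INR n.+1 + 2) * (INR n.+1 + 3) - 2 - A) * (f * T).
  by have := Rmult_le_compat_l (2 * (INR n.+1 + 2)) _ _ ltac:(lra) Tf; lra.
apply: Rmult_le_compat_r => //; rewrite /A S_INR; have := pos_INR n; nra.
Qed.

(** One factor [INR n.+2] is the [k] granted to the layer forcing by [relaxation_bound], the other
    is the quotient of consecutive factorials, and [Q] is the missing power of the layer ratio. *)
Lemma top_rate (n : nat) :
  2 * kappa * (\big[Rplus/0]_(l < n.+2) top l) <= INR n.+2 * (INR n.+2 * top n.+2) * Q.
Proof.
have := sum_top n; set G := \big[_/_]_(_ < _) _ => HG.
have e0 := eps_pos; have T1 := T_ge1; have B2 := two_kappa_le_B; have BQ := B_le_Q.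
have n0 := pos_INR n.
have -> : INR n.+2 * (INR n.+2 * top n.+2) =
   2 * (INR n + 2) + 3 / 2 * (INR n + 2) ^ 2 * (INR n + 3) * (eps * T).
  by rewrite /top !S_INR; field; lra.
have eT : 0 < eps * T by apply: Rmult_lt_0_compat; lra.
set A := 1 + 3 / 4 * (INR n + 1) * (INR n + 4) in HG.
have A0 : 0 <= A by rewrite /A; have := Rmult_le_pos (INR n + 1) (INR n + 4) ltac:(lra) ltac:(lra); lra.
have k2 : 0 <= 2 * kappa by lra.
apply: Rle_trans (Rmult_le_compat_l _ _ _ k2 HG) _.
have -> : 2 * kappa * (m * B * T + (INR n + 1) + eps * T * A) =
  2 * (eps * T) * B + (2 * kappa) * ((INR n + 1) + eps * T * A) by rewrite /eps; ring.
have eTA := Rmult_le_pos _ _ (Rlt_le _ _ eT) A0.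
have H1 : 2 * kappa * (INR n + 1 + eps * T * A) <= Q * (INR n + 1 + eps * T * A).
  by apply: Rmult_le_compat_r; lra.
have H2 : 2 * (eps * T) * B <= 2 * (eps * T) * Q by apply: Rmult_le_compat_l; lra.
suff : 2 * (eps * T) + (INR n + 1 + eps * T * A) <=
    2 * (INR n + 2) + 3 / 2 * (INR n + 2) ^ 2 * (INR n + 3) * (eps * T).
  by move=> H; have := Rmult_le_compat_r Q _ _ ltac:(lra) H; lra.
have : (2 + A) * (eps * T) <= 3 / 2 * (INR n + 2) ^ 2 * (INR n + 3) * (eps * T).
  by apply: Rmult_le_compat_r; [lra | rewrite /A; nra].
by lra.
Qed.

(** The analogue of [top_rate] for one phase. All of the forcing is charged to the term with
    [9 / 8 * (eps * T)], so the summand [INR n + 1] of [sum_top], which lacks [eps], has to pass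
    through [kappa_le_Q]. *)
Lemma top_rate_norm (n : nat) :
  kappa * (\big[Rplus/0]_(l < n.+2) top l) <= INR n.+2 ^ 2 * (9 / 8 * (eps * T)) * Q.
Proof.
have := sum_top n; set G := \big[_/_]_(_ < _) _ => HG.
have e0 := eps_pos; have T1 := T_ge1; have B2 := two_kappa_le_B; have BQ := B_le_Q.
have n0 := pos_INR n; have kQ := kappa_le_Q.
have eT : 0 < eps * T by apply: Rmult_lt_0_compat; lra.
set A := 1 + 3 / 4 * (INR n + 1) * (INR n + 4) in HG.
have A0 : 0 <= A by rewrite /A; have := Rmult_le_pos (INR n + 1) (INR n + 4) ltac:(lra) ltac:(lra); lra.
apply: Rle_trans (Rmult_le_compat_l _ _ _ (Rlt_le _ _ kappa0) HG) _.
have -> : kappa * (m * B * T + (INR n + 1) + eps * T * A) =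
  (eps * T) * B + kappa * (INR n + 1) + / 2 * ((2 * kappa) * (eps * T * A)).
  by rewrite /eps; field.
have eTA := Rmult_le_pos _ _ (Rlt_le _ _ eT) A0.
have H1 : 2 * kappa * (eps * T * A) <= Q * (eps * T * A) by apply: Rmult_le_compat_r; lra.
have H2 : (eps * T) * B <= (eps * T) * Q by apply: Rmult_le_compat_l; lra.
have H3 : kappa * (INR n + 1) <= 8 / 9 * (eps * T * Q) * (INR n + 1).
  apply: Rmult_le_compat_r; first lra.
  apply: Rle_trans kQ _.
  have := Rmult_le_pos eps Q ltac:(lra) ltac:(lra) => eQ.
  by have := Rmult_le_compat_l (eps * Q) _ _ eQ T1; lra.
suff : (1 + 8 / 9 * (INR n + 1) + / 2 * A) * (eps * T * Q) <= INR n.+2 ^ 2 * (9 / 8) * (eps * T * Q) by lra.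
apply: Rmult_le_compat_r; first by apply: Rmult_le_pos; lra.
by rewrite /A !S_INR; nra.
Qed.

Lemma del_pair_le (n : nat) (s : R) : 0 <= s <= t -> forall i j,
  Rabs (del n j s - del n i s) <=
    INR n`! * mix (exp (- s / m)) (top n * x s ^ n) (bot n * B ^ n).
Proof.
elim/ltn_ind: n s => n IH s [s0 st] i j.
have e0 := eps_pos; have T1 := T_ge1; have B2 := two_kappa_le_B; have BQ := B_le_Q.
have eT : 0 < eps * T by apply: Rmult_lt_0_compat; lra.
have KB := K_le_B; have Kp := K_pos; have Bx := B_le_x.
have es := exp_decay m0 s0.
case: n IH => [|[|n]] IH.
- rewrite fact0 INR_1 /= /mix.
  apply: Rle_trans (del0_pair_le_exp i j (conj s0 st)) _; rewrite -/T.
  have := Rmult_le_compat_r (m * T) _ _ ltac:(apply: Rmult_le_pos; lra) KB; lra.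
(* At order 1 the layer entry [1] comes from [K <= x s], and [4 * eps * T] from two forcing terms,
   each at most [eps * T * B], doubled for the pair. Its copy in [top 1] keeps [bot 1 <= top 1]. *)
- rewrite INR_factS fact0 !INR_1 /= /mix.
  apply: Rle_trans (del1_pair_le i j s0) _.
  have [xB xQ] := Bx s s0; set e := exp (- s / m) in es *.
  have HT : exp (2 * kappa * s) <= T by exact: exp2k_mono.
  have HB : diam nu + 2 * kappa <= B by rewrite /B; have := diam_ge0 omega0 N0; lra.
  have H1 : m * kappa * (diam nu + 2 * kappa) <= eps * B by apply: Rmult_le_compat_l; rewrite -/eps; lra.
  have H1' : eps * B <= eps * T * B.
    by apply: Rmult_le_compat_r; [lra | have := Rmult_le_compat_l eps _ _ ltac:(lra) T1; lra].
  have H2 : m * kappa * K * exp (2 * kappa * s) <= eps * T * B.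
    have : eps * (K * exp (2 * kappa * s)) <= eps * (B * T).
      apply: Rmult_le_compat_l; first lra.
      by apply: Rmult_le_compat; first lra; first exact: Rlt_le (exp_pos _).
    by rewrite /eps; lra.
  have H3 : 2 * (m * kappa * (diam nu + 2 * kappa) + m * kappa * K * exp (2 * kappa * s)) * (1 - e)
     <= 4 * (eps * T * B) * (1 - e) by apply: Rmult_le_compat_r; lra.
  have H4 : K * e <= e * x s by rewrite Rmult_comm; apply: Rmult_le_compat_l; lra.
  have H5 : 0 <= e * (4 * (eps * T) * x s) by apply: Rmult_le_pos; [|apply: Rmult_le_pos]; lra.
  lra.
have Q0 : 0 <= Q by lra.
have f0 k : 0 <= INR k`! by exact: pos_INR.
have [b0 bt] := bot_le_top n.+2.
have -> : INR (n.+2)`! * mix (exp (- s / m)) (top n.+2 * x s ^ n.+2) (bot n.+2 * B ^ n.+2) =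
  INR (n.+2)`! * (top n.+2 * Q ^ n.+2) * (1 + s / m) ^ n.+2 * exp (- s / m) +
  INR (n.+2)`! * (bot n.+2 * B ^ n.+2) * (1 - exp (- s / m)).
  by rewrite /mix /x Rpow_mult_distr; ring.
apply: (relaxation_bound (y := fun s => del n.+2 j s - del n.+2 i s)
  (dy := fun s => del n.+3 j s - del n.+3 i s)) => //.
- by nonneg.
- by nonneg.
- by move=> r [r0 _]; apply: is_derive_half_minus => //; exact: del_is_derive.
- have z0 := Rle_refl 0.
  have Sp := first_order_smooth Hp; have Sq := inertial_smooth m0 Hq.
  have Hqq := inertial_pair_le_mix n.+1 i j z0; have Hpp := first_order_pair_le_mix n.+1 i j z0.
  have E0 : mix (exp (- 0 / m)) (x 0 ^ n.+2) (B ^ n.+2) = Q ^ n.+2.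
    rewrite /x Ropp_0 /Rdiv Rmult_0_l exp_0 Rplus_0_r Rmult_1_r /mix; ring.
  rewrite E0 !Derive_half_n_minus // in Hqq Hpp; try exact: Sp; try exact: Sq.
  have -> : del n.+2 j 0 - del n.+2 i 0 = (Derive_half_n n.+2 (q j) 0 - Derive_half_n n.+2 (q i) 0)
     + - (Derive_half_n n.+2 (p j) 0 - Derive_half_n n.+2 (p i) 0) by rewrite /del; ring.
  apply: Rle_trans (Rabs_triang _ _) _; rewrite Rabs_Ropp.
  (* At time 0 each of the two solutions contributes at most [(n + 1)! * Q ^ n.+2]; this is the term
     [2 / INR k] of [top]. *)
  have -> : INR (n.+2)`! * (top n.+2 * Q ^ n.+2) =
    2 * (INR (n.+1)`! * Q ^ n.+2) + INR (n.+2)`! * (bot n.+2 * Q ^ n.+2).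
    by rewrite /top /bot !INR_factS; field; rewrite S_INR; have := pos_INR n.+1; lra.
  have : 0 <= INR (n.+2)`! * (bot n.+2 * Q ^ n.+2) by nonneg.
  lra.
- move=> r [r0 rs].
  have IHr k : (k <= n.+1)%N -> forall i j, Rabs (del k j r - del k i r) <=
     INR k`! * mix (exp (- r / m)) (top k * x r ^ k) (bot k * B ^ k).
    by move=> kn i' j'; apply: IH => //; lra.
  have -> : m * (del n.+3 j r - del n.+3 i r) + (del n.+2 j r - del n.+2 i r) =
    (m * del n.+3 j r + del n.+2 j r) + - (m * del n.+3 i r + del n.+2 i r) by ring.
  apply: Rle_trans (Rabs_triang _ _) _; rewrite Rabs_Ropp.
  have := del_rhs_le i r0 IHr; have := del_rhs_le j r0 IHr.
  have er := exp_decay m0 r0; have rm := Rdiv_le_0_compat _ _ r0 m0.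
  have := bottom_rate n; have := top_rate n.
  have Gb0 : 0 <= \big[Rplus/0]_(l < n.+2) bot l.
    apply: (big_ind (fun y => 0 <= y)); [exact: Rle_refl | move=> *; lra | ].
    by move=> l _; case: (bot_le_top l).
  set Gt := \big[_/_]_(_ < _) top _; set Gb := \big[_/_]_(_ < _) bot _ in Gb0 *.
  move=> Ht Hb Hj Hi.
  set e := exp (- r / m) in er Hi Hj *.
  set f := INR (n.+1)`! in Hi Hj Hb *.
  have ff : INR (n.+2)`! = INR n.+2 * f by rewrite INR_factS.
  pose W := f * (e * (Q ^ n.+1 * (1 + r / m) ^ n.+1)).
  have W0 : 0 <= W by nonneg.
  have Y0 : 0 <= f * (Gb * B ^ n.+1) by nonneg.
  set Y := f * (Gb * B ^ n.+1) in Y0 Hb.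
  have Em : f * mix e (Gt * x r ^ n.+1) (Gb * B ^ n.+1) = Gt * W + (1 - e) * Y.
    by rewrite /mix /x /W /Y Rpow_mult_distr; ring.
  rewrite Em in Hi Hj.
  have -> : INR n.+2 * (INR (n.+2)`! * (top n.+2 * Q ^ n.+2)) * (1 + r / m) ^ (n.+2).-1 * e =
    INR n.+2 * (INR n.+2 * top n.+2) * Q * W by rewrite ff /W /=; ring.
  have H1 := Rmult_le_compat_r W _ _ W0 Ht.
  have eY : 0 <= 2 * kappa * (e * Y) by nonneg.
  lra.
Qed.

Let P := 2 * kappa + norm_inf omega0 + norm_inf nu + 9 / (8 * m).
Let S0 := norm_inf omega0 + norm_inf nu + kappa.

(** Each order divides the previous initial derivative by [m], which propagates the data [S0] as a
    pure power of [/ m]. The coupling terms fed in on the way depend on phase differences only,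
    hence on [Q], and carry [eps] because [kappa = eps * / m]. *)
Lemma inertial_init_le (n : nat) (i : 'I_N) :
  Rabs (Derive_half_n n.+2 (q i) 0) <=
    S0 * (/ m) ^ n.+1 + INR (n.+1)`! * (eps * Q ^ n.+2).
Proof.
have e0 := eps_pos; have B2 := two_kappa_le_B; have BQ := B_le_Q; have mQ := invm_Q.
have z0 := Rle_refl 0; have im := Rinv_0_lt_compat _ m0; have Q0 : 0 <= Q by lra.
elim: n => [|n IH].
  have -> : Derive_half_n 2 (q i) 0 = / m * (nu i + Cq i 0 + - omega0 i).
    have := inertialE1 Hq i z0; rewrite velocity_init -/(Cq i 0) => H.
    have -> : nu i + Cq i 0 + - omega0 i = m * Derive_half_n 2 (q i) 0 by lra.
    by field; lra.
  rewrite Rabs_mult Rabs_pos_eq; last lra.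
  have : 0 <= INR 1`! * (eps * Q ^ 2).
    by nonneg.
  have : Rabs (nu i + Cq i 0 + - omega0 i) <= S0.
    apply: Rle_trans (Rabs_triang _ _) _; rewrite Rabs_Ropp.
    have := Rabs_triang (nu i) (Cq i 0); have := coupling_le N0 kappa0 (q^~ 0) i.
    have := norm_inf_ge nu i; have := norm_inf_ge omega0 i.
    by rewrite /S0 /Cq; lra.
  by move=> H; have := Rmult_le_compat_l (/ m) _ _ ltac:(lra) H; rewrite /= Rmult_1_r; lra.
have E : Derive_half_n n.+3 (q i) 0 = / m * (Derive_half_n n.+1 (Cq i) 0 + - Derive_half_n n.+2 (q i) 0).
  have := inertialE m0 Hq n i z0; rewrite -/(Cq i) => <-; field; lra.
rewrite E Rabs_mult Rabs_pos_eq; last lra.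
set f := INR (n.+1)`! in IH *.
have f0 : 0 <= f by exact: pos_INR.
set X := Q ^ n.+1; have X0 : 0 <= X by exact: pow_le.
have HC : Rabs (Derive_half_n n.+1 (Cq i) 0) <= kappa * (f * X).
  have Sq := inertial_smooth m0 Hq.
  apply: Derive_half_n_coupling_le => // l.
  have [] := Derive_half_n_sin_cos_le (exp_decay m0 z0) (proj1 (B_le_x z0)) z0
    (smooth_minus (Sq n.+1 l) (Sq n.+1 i)) _ (leqnn n.+1).
    by move=> k _; exact: inertial_pair_le_mix.
  move=> H _; apply: Rle_trans H _; right.
  rewrite /x Ropp_0 /Rdiv Rmult_0_l exp_0 Rplus_0_r Rmult_1_r /mix /X /f; ring.
have Htri : Rabs (Derive_half_n n.+1 (Cq i) 0 + - Derive_half_n n.+2 (q i) 0) <=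
   kappa * (f * X) + (S0 * (/ m) ^ n.+1 + f * (eps * (Q * X))).
  by apply: Rle_trans (Rabs_triang _ _) _; rewrite Rabs_Ropp; apply: Rplus_le_compat.
apply: Rle_trans (Rmult_le_compat_l _ _ _ (Rlt_le _ _ im) Htri) _.
have eq1 : kappa = eps * / m by rewrite /eps; field; lra.
rewrite (INR_factS n.+1) -/f.
have -> : / m * (kappa * (f * X) + (S0 * (/ m) ^ n.+1 + f * (eps * (Q * X)))) =
  S0 * (/ m) ^ n.+2 + (f * (eps * X)) * (/ m * / m + / m * Q) by rewrite {1}eq1 -/(pow _ n.+1) /=; ring.
have -> : Q ^ n.+3 = Q * Q * X by rewrite /X /=; ring.
have F0 : 0 <= f * (eps * X) by nonneg.
have mQ' : / m <= Q by lra.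
have h1 : / m * / m <= Q * Q by apply: Rmult_le_compat; lra.
have h2 : / m * Q <= Q * Q by apply: Rmult_le_compat_r; lra.
have H := Rmult_le_compat_l _ _ _ F0 (Rplus_le_compat _ _ _ _ h1 h2).
have n0 := pos_INR n.
have := Rmult_le_pos _ _ n0 (Rmult_le_pos _ _ F0 (Rmult_le_pos _ _ Q0 Q0)).
by rewrite !S_INR; lra.
Qed.

Lemma del_init_le (n : nat) (i : 'I_N) :
  Rabs (del n.+2 i 0) <=
    INR (n.+1)`! * P ^ n.+2 + 9 / 8 * (eps * T) * INR (n.+2)`! * Q ^ n.+2.
Proof.
have e0 := eps_pos; have B2 := two_kappa_le_B; have BQ := B_le_Q; have mQ := invm_Q.
have T1 := T_ge1; have kQ := kappa_le_Q.
have z0 := Rle_refl 0; have im := Rinv_0_lt_compat _ m0; have Q0 : 0 <= Q by lra.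
have [w0 v0] := (norm_inf_ge0 omega0 N0, norm_inf_ge0 nu N0).
apply: Rle_trans (Rabs_triang _ _) _; rewrite Rabs_Ropp.
rewrite (first_orderE Hp) // -/(Cp i).
have HB : diam nu + 2 * kappa <= B by rewrite /B; have := diam_ge0 omega0 N0; lra.
have H1 := inertial_init_le n i.
have H2 := first_order_coupling_derive_le n.+1 i HB z0.
have f1 := fact_ge1 n.+1; have f0 : 0 <= INR (n.+1)`! by lra.
have mP : 9 / (8 * m) = 9 / 8 * / m by field; lra.
(* Both [S0] and [/ m] are at most [P]. *)
have HP : S0 * (/ m) ^ n.+1 <= INR (n.+1)`! * P ^ n.+2.
  have P0 : 0 <= P by rewrite /P mP; lra.
  have Hpow : S0 * (/ m) ^ n.+1 <= P * P ^ n.+1.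
    apply: Rmult_le_compat; [rewrite /S0; lra | by apply: pow_le; lra | by rewrite /S0 /P mP; lra | ].
    by apply: pow_incr; rewrite /P mP; lra.
  have := Rmult_le_compat_r (P ^ n.+2) _ _ (pow_le _ _ P0) f1.
  by rewrite -[P ^ n.+2]/(P * P ^ n.+1); lra.
set f := INR (n.+1)`! in f1 f0 H1 H2 HP *.
set X := Q ^ n.+2 in H1 *; have X0 : 0 <= X by exact: pow_le.
have H3 : kappa * (f * B ^ n.+1) <= f * (eps * X).
  have Bp : B ^ n.+1 <= Q ^ n.+1 by apply: pow_incr; lra.
  have Bp0 : 0 <= B ^ n.+1 by apply: pow_le; lra.
  have eQ := Rmult_le_pos eps Q ltac:(lra) Q0.
  have : kappa * B ^ n.+1 <= (eps * Q) * Q ^ n.+1 by apply: Rmult_le_compat; lra.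
  move=> H; have := Rmult_le_compat_l f _ _ f0 H.
  by rewrite /X -[Q ^ n.+2]/(Q * Q ^ n.+1); lra.
rewrite (INR_factS n.+1) -/f !S_INR.
have F0 : 0 <= f * (eps * X) by nonneg.
have n0 := pos_INR n.
have FT : f * (eps * X) <= f * (eps * X) * T.
  by rewrite -[X in X <= _]Rmult_1_r; apply: Rmult_le_compat_l.
have := Rmult_le_pos _ _ n0 (Rle_trans _ _ _ F0 FT).
lra.
Qed.

(** The forcing is controlled by [del_pair_le] at lower orders, so a single relaxation argument
    suffices. *)
Lemma del_le (n : nat) (i : 'I_N) :
  Rabs (del n.+2 i t) <=
    (INR (n.+1)`! * P ^ n.+2 + 9 / 8 * (eps * T) * INR (n.+2)`! * Q ^ n.+2)
       * (1 + t / m) ^ n.+2 * exp (- t / m)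
    + 3 / 4 * (eps * T) * INR (n.+3)`! * B ^ n.+2 * (1 - exp (- t / m)).
Proof.
have e0 := eps_pos; have T1 := T_ge1; have B2 := two_kappa_le_B; have BQ := B_le_Q.
have eT : 0 < eps * T by apply: Rmult_lt_0_compat; lra.
have Q0 : 0 <= Q by lra.
have [w0 v0] := (norm_inf_ge0 omega0 N0, norm_inf_ge0 nu N0).
have P0 : 0 <= P.
  have : 0 < 9 / (8 * m) by apply: Rdiv_lt_0_compat; lra.
  by rewrite /P; lra.
have f0 k : 0 <= INR k`! by exact: pos_INR.
have a1 : 0 <= INR (n.+1)`! * P ^ n.+2 by apply: Rmult_le_pos => //; exact: pow_le.
have a2 : 0 <= 9 / 8 * (eps * T) * INR (n.+2)`! * Q ^ n.+2.
  by nonneg.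
apply: (relaxation_bound (y := del n.+2 i) (dy := del n.+3 i)) => //; try lra.
- by nonneg.
- by move=> r [r0 _]; exact: del_is_derive.
- exact: del_init_le.
- move=> r [r0 rs].
  have IHr k : (k <= n.+1)%N -> forall i j, Rabs (del k j r - del k i r) <=
     INR k`! * mix (exp (- r / m)) (top k * x r ^ k) (bot k * B ^ k).
    by move=> kn i' j'; apply: del_pair_le.
  have := del_rhs_le i r0 IHr.
  have er := exp_decay m0 r0; have rm := Rdiv_le_0_compat _ _ r0 m0.
  have := bottom_rate n; have := top_rate_norm n.
  have Gb0 : 0 <= \big[Rplus/0]_(l < n.+2) bot l.
    apply: (big_ind (fun y => 0 <= y)); [exact: Rle_refl | move=> *; lra | ].
    by move=> l _; case: (bot_le_top l).
  set Gt := \big[_/_]_(_ < _) top _; set Gb := \big[_/_]_(_ < _) bot _ in Gb0 *.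
  move=> Ht Hb Hi.
  set e := exp (- r / m) in er Hi *.
  have fS : INR (n.+3)`! = INR n.+3 * INR (n.+2)`! by rewrite INR_factS.
  have ff : INR (n.+2)`! = INR n.+2 * INR (n.+1)`! by rewrite INR_factS.
  set f := INR (n.+1)`! in Hi Hb ff a1 *.
  pose W := f * (e * (Q ^ n.+1 * (1 + r / m) ^ n.+1)).
  have W0 : 0 <= W by nonneg.
  have Y0 : 0 <= f * (Gb * B ^ n.+1) by nonneg.
  set Y := f * (Gb * B ^ n.+1) in Y0 Hb.
  have Em : f * mix e (Gt * x r ^ n.+1) (Gb * B ^ n.+1) = Gt * W + (1 - e) * Y.
    by rewrite /mix /x /W /Y Rpow_mult_distr; ring.
  rewrite Em in Hi.
  have Eb : 3 / 4 * (eps * T) * INR (n.+3)`! * B ^ n.+2 = / 2 * (INR (n.+2)`! * (bot n.+2 * B ^ n.+2)).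
    by rewrite fS /bot; field.
  have -> : INR n.+2 * (f * P ^ n.+2 + 9 / 8 * (eps * T) * INR (n.+2)`! * Q ^ n.+2) * (1 + r / m) ^ (n.+2).-1 * e =
    INR n.+2 * (f * P ^ n.+2) * (1 + r / m) ^ n.+1 * e + INR n.+2 ^ 2 * (9 / 8 * (eps * T)) * Q * W.
    by rewrite ff /W /=; ring.
  (* The [P] part carries initial values only; its share of the admissible forcing is discarded. *)
  have : 0 <= INR n.+2 * (f * P ^ n.+2) * (1 + r / m) ^ n.+1 * e.
    by nonneg.
  have H1 := Rmult_le_compat_r W _ _ W0 Ht.
  have eY : 0 <= kappa * (e * Y) by nonneg.
  rewrite Eb; lra.
Qed.

End HigherOrder.

End Comparison.

(** * The limit of vanishing inertia *)

Lemma exp_neg_le_pow (j : nat) (y : R) : 0 < y -> exp (- (INR j * y)) <= (/ y) ^ j.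
Proof.
move=> y0; elim: j => [|j IH].
  by rewrite Rmult_0_l Ropp_0 exp_0; exact: Rle_refl.
have -> : - (INR j.+1 * y) = - y + - (INR j * y) by rewrite S_INR; ring.
rewrite exp_plus; apply: Rmult_le_compat => //; try exact: Rlt_le (exp_pos _).
rewrite exp_Ropp; apply: Rinv_le_contravar => //.
by have := exp_ineq1_le y; lra.
Qed.

(** Away from [t = 0] the exponential beats every power of [/ m]. The two powers grow like
    [(/ m) ^ (k + k)], so decay of order [j = 2 k + 1] leaves one factor [m]. *)
Lemma initial_layer_le (a b c : R) (k : nat) : 0 < a <= b -> 0 <= c ->
  exists M, 0 <= M /\ forall m t, 0 < m < 1 -> a <= t <= b ->
    (c + 9 / (8 * m)) ^ k * (1 + t / m) ^ k * exp (- t / m) <= M * m.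
Proof.
move=> [a0 ab] c0; pose j := (k + k).+1.
have j0 : 0 < INR j by apply: lt_0_INR; apply/ltP.
exists ((c + 2) ^ k * (1 + b) ^ k * (INR j / a) ^ j); split.
  have ja : 0 < INR j / a by exact: Rdiv_lt_0_compat.
  by nonneg.
move=> m t [m0 m1] [at_ tb].
have im0 := Rinv_0_lt_compat _ m0.
have im : 1 <= / m by rewrite -Rinv_1; apply: Rinv_le_contravar; lra.
have -> : 9 / (8 * m) = 9 / 8 * / m by field; lra.
have tm : t / m <= b * / m by apply: Rmult_le_compat_r; lra.
have tm0 : 0 < t / m by apply: Rdiv_lt_0_compat; lra.
(* Uses [1 <= / m] for [c] and [9 / 8 <= 2]. *)
have H1 : (c + 9 / 8 * / m) ^ k <= ((c + 2) * / m) ^ k.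
  apply: pow_incr; have := Rmult_le_compat_l c _ _ c0 im; lra.
have H2 : (1 + t / m) ^ k <= ((1 + b) * / m) ^ k by apply: pow_incr; lra.
have H3 : exp (- t / m) <= (INR j / a * m) ^ j.
  have y0 : 0 < a / m / INR j by repeat apply: Rdiv_lt_0_compat.
  have -> : INR j / a * m = / (a / m / INR j) by field; lra.
  apply: Rle_trans (exp_neg_le_pow j y0); apply: exp_le_mono.
  have -> : INR j * (a / m / INR j) = a * / m by field; lra.
  have := Rmult_le_compat_r _ _ _ (Rlt_le _ _ im0) at_; rewrite /Rdiv; lra.
have e0 := exp_pos (- t / m).
have ic : 0 <= c + 9 / 8 * / m by lra.
have it : 0 <= 1 + t / m by lra.
apply: (Rle_trans _ (((c + 2) * / m) ^ k * ((1 + b) * / m) ^ k * (INR j / a * m) ^ j)).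
  by apply: Rmult_le_compat => //; [nonneg | nonneg | apply: Rmult_le_compat => //; nonneg].
right; rewrite !Rpow_mult_distr.
have E : (/ m) ^ k * (/ m) ^ k * m ^ j = m.
  rewrite /j -tech_pow_Rmult -[(k + k)%N]/(Nat.add k k) pow_add.
  have Ek : (/ m) ^ k * m ^ k = 1 by rewrite -Rpow_mult_distr Rinv_l ?pow1 //; lra.
  have -> : (/ m) ^ k * (/ m) ^ k * (m * (m ^ k * m ^ k)) = m * (((/ m) ^ k * m ^ k) * ((/ m) ^ k * m ^ k)) by ring.
  by rewrite Ek; ring.
by rewrite -[in RHS]E; ring.
Qed.

Lemma continuous_on_half (I : R -> Prop) (f : R -> R) :
  (forall s, I s -> 0 <= s) -> (forall s, I s -> ex_derive_half f s) -> continuous_on I f.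
Proof.
move=> I0 Hf s Is; have [l /(half_deriveP _ _ (I0 s Is)) [F [HF EF]]] := Hf s Is.
have HC : filterlim F (locally s) (locally (F s)) by apply: ex_derive_continuous; exists l.
rewrite EF in HC; last exact: I0.
move=> P /HC H; move: H; rewrite /filtermap /within /=; apply: filter_imp => r Hr Ir.
by rewrite -EF //; exact: I0.
Qed.

Lemma cvg_C0_linear (N : nat) (I : R -> Prop) (F : R -> 'I_N -> R -> R) (f : 'I_N -> R -> R) :
  (forall m i, 0 < m -> continuous_on I (F m i)) ->
  (forall i, continuous_on I (f i)) ->
  (forall a b, a <= b -> I a -> exists M, forall m t, 0 < m < 1 -> a <= t <= b ->
     norm_inf (fun i => F m i t - f i t) <= M * m) ->
  cvg_C0 I F f.
Proof.
move=> HF Hf H; split=> //; split=> // a b ab Hab eps.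
have [M HM] := H a b ab (Hab a (conj (Rle_refl a) ab)).
have e0 := cond_pos eps; have M0 := Rabs_pos M.
(* No sign is assumed on [M]; [Rabs M + 1] is a safe positive denominator. *)
have d0 : 0 < Rmin 1 (eps / (Rabs M + 1)).
  by apply: Rmin_glb_lt; [lra | apply: Rdiv_lt_0_compat; lra].
exists (mkposreal _ d0) => m.
rewrite /ball /= /AbsRing_ball /abs /minus /plus /opp /= => + m0 t Ht.
rewrite Ropp_0 Rplus_0_r Rabs_pos_eq; last lra.
move=> Hm; have m1 : m < 1 by apply: Rlt_le_trans Hm (Rmin_l _ _).
have me : m < eps / (Rabs M + 1) by apply: Rlt_le_trans Hm (Rmin_r _ _).
apply: Rle_lt_trans (HM m t (conj m0 m1) Ht) _.
have /Rlt_div_r : m < eps / (Rabs M + 1) by [].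
move=> /(_ ltac:(lra)); have := Rmult_le_compat_r m _ _ (Rlt_le _ _ m0) (Rle_abs M); lra.
Qed.

Unset Implicit Arguments.

Theorem proposition3p2 (N : nat) (theta0 omega0 nu : 'I_N -> R) (kappa : R)
    (Theta : R -> 'I_N -> R -> R) :
  (1 <= N)%N ->
  0 < kappa ->
  first_order_kuramoto kappa nu theta0 (Theta 0) ->
  (forall m, 0 < m -> inertial_kuramoto m kappa nu theta0 omega0 (Theta m)) ->
  let slip := fun i => omega0 i - nu i in
  let Theta_diff := fun (n : nat) (m t : R) (i : 'I_N) =>
    Derive_half_n n (Theta m i) t - Derive_half_n n (Theta 0 i) t in
  (cvg_C0 (Rle 0) Theta (Theta 0) /\
   forall m t, 0 < m -> 0 <= t ->
     norm_inf (Theta_diff 0%N m t)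
       < m * Rabs ((vmax slip + vmin slip) / 2)
         + 1 / 2 * m * (diam slip + 2 * kappa) * exp (2 * kappa * t) /\
     diam (Theta_diff 0%N m t)
       < m * (diam slip + 2 * kappa) * exp (2 * kappa * t)) /\
  (cvg_C0 (Rlt 0) (fun m i => Derive_half (Theta m i))
                  (fun i => Derive_half (Theta 0 i)) /\
   forall m t, 0 < m -> 0 <= t ->
     norm_inf (Theta_diff 1%N m t)
       < (norm_inf slip + kappa) * exp (- t / m)
         + m * kappa * (diam nu + 2 * kappa)
         + m * kappa * (diam slip + 2 * kappa) * exp (2 * kappa * t) /\
     diam (Theta_diff 1%N m t)
       < (diam slip + 2 * kappa) * exp (- t / m)
         + 2 * m * kappa * (diam nu + 2 * kappa)
         + 2 * m * kappa * (diam slip + 2 * kappa) * exp (2 * kappa * t)) /\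
  (cvg_Cinfty Theta (Theta 0) /\
   forall m n t, 0 < m -> (2 <= n)%N -> 0 <= t ->
     norm_inf (Theta_diff n m t)
       <= INR (n.-1)`!
            * (2 * kappa + norm_inf omega0 + norm_inf nu + 9 / (8 * m)) ^ n
            * (1 + t / m) ^ n * exp (- t / m)
          + 9 / 8 * m * kappa * INR n`! * exp (2 * kappa * t)
            * (2 * kappa + diam omega0 + diam nu + 9 / (8 * m)) ^ n
            * (1 + t / m) ^ n * exp (- t / m)
          + 3 / 4 * m * kappa * INR (n.+1)`! * exp (2 * kappa * t)
            * (2 * kappa + diam omega0 + diam nu) ^ n
            * (1 - exp (- t / m)) /\
     diam (Theta_diff n m t)
       <= 2 * INR (n.-1)`!
            * (2 * kappa + diam omega0 + diam nu + 9 / (8 * m)) ^ n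
            * (1 + t / m) ^ n * exp (- t / m)
          + 3 / 2 * INR (n.+1)`! * m * kappa * exp (2 * kappa * t)
            * (2 * kappa + diam omega0 + diam nu + 9 / (8 * m)) ^ n
            * (1 + t / m) ^ n * exp (- t / m)
          + 3 / 2 * INR (n.+1)`! * m * kappa * exp (2 * kappa * t)
            * (2 * kappa + diam omega0 + diam nu) ^ n
            * (1 - exp (- t / m))).
Proof.
move=> N0 kappa0 Hp Hq slip Theta_diff.
have d0 := diam_ge0 slip N0; have dn0 := diam_ge0 nu N0; have dw0 := diam_ge0 omega0 N0.
have nw0 := norm_inf_ge0 omega0 N0; have nn0 := norm_inf_ge0 nu N0.
have ns0 := norm_inf_ge0 slip N0.
have Sp := first_order_smooth Hp.
have Sq m (m0 : 0 < m) := inertial_smooth m0 (Hq m m0).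
have decay m t : 0 < exp (- t / m) by exact: exp_pos.
(* The quantitative bounds are proved before the convergences, which are read off them. *)
have regroup (A0 B0 A1 B1 A2 B2 : Prop) : B0 -> B1 -> B2 ->
    (B0 -> B1 -> B2 -> A0 /\ A1 /\ A2) -> (A0 /\ B0) /\ (A1 /\ B1) /\ (A2 /\ B2) by tauto.
apply: regroup.
(* Strictness in the first two groups of estimates comes from dropping a positive multiple of
   [exp (- t / m)]. *)
- move=> m t m0 t0; have e0 := decay m t.
  have mK : 0 < m * (diam slip + 2 * kappa) by apply: Rmult_lt_0_compat; lra.
  split.
    have [i ->] := norm_inf_attained (Theta_diff 0%N m t) N0.
    apply: Rle_lt_trans (del0_le N0 kappa0 m0 Hp (Hq m m0) i t0) _.
    rewrite -/slip; set mid := Rabs _.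
    have mid0 : 0 <= m * mid * exp (- t / m) by have := Rabs_pos ((vmax slip + vmin slip) / 2); rewrite -/mid => ?; nonneg.
    have := Rmult_lt_0_compat _ _ mK e0; lra.
  have [i [j ->]] := diam_attained (Theta_diff 0%N m t) N0.
  apply: Rle_lt_trans (del0_pair_le N0 kappa0 m0 Hp (Hq m m0) j i t0) _.
  by rewrite -/slip; have := Rmult_lt_0_compat _ _ mK e0; lra.
- move=> m t m0 t0; have e0 := decay m t; have mk := Rmult_lt_0_compat _ _ m0 kappa0.
  pose r := m * kappa * (diam nu + 2 * kappa) + m * kappa * (diam slip + 2 * kappa) * exp (2 * kappa * t).
  have r0 : 0 < r.
    apply: Rplus_lt_0_compat; first by apply: Rmult_lt_0_compat; lra.
    by apply: Rmult_lt_0_compat (exp_pos _); apply: Rmult_lt_0_compat; lra.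
  have re0 := Rmult_lt_0_compat _ _ r0 e0.
  split.
    have [i ->] := norm_inf_attained (Theta_diff 1%N m t) N0.
    apply: Rle_lt_trans (del1_le N0 kappa0 m0 Hp (Hq m m0) i t0) _.
    by rewrite -/slip -/r; rewrite /r in re0 *; lra.
  have [i [j ->]] := diam_attained (Theta_diff 1%N m t) N0.
  apply: Rle_lt_trans (del1_pair_le N0 kappa0 m0 Hp (Hq m m0) j i t0) _.
  by rewrite -/slip -/r; rewrite /r in re0 *; lra.
- move=> m [//|[//|n]] t m0 _ t0.
  have -> : 2 * kappa + diam omega0 + diam nu = diam omega0 + diam nu + 2 * kappa by ring.
  split.
    have [i ->] := norm_inf_attained (Theta_diff n.+2 m t) N0.
    apply: Rle_trans (del_le N0 kappa0 m0 Hp (Hq m m0) t0 n i) _.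
    by right; rewrite -[(n.+2).-1]/(n.+1); ring.
  have [i [j ->]] := diam_attained (Theta_diff n.+2 m t) N0.
  apply: Rle_trans (del_pair_le N0 kappa0 m0 Hp (Hq m m0) t0 n.+2 (conj t0 (Rle_refl t)) j i) _.
  right; rewrite -[(n.+2).-1]/(n.+1) /mix Rpow_mult_distr (INR_factS n.+2) (INR_factS n.+1).
  by field; have := pos_INR n; rewrite !S_INR; lra.
move=> bound0 bound1 boundn.
have dT n i t : 0 <= t -> ex_derive_half (Derive_half_n n (Theta 0 i)) t.
  by move=> t0; eexists; exact: (is_derive_half_Derive_half_n t0 (Sp n.+1 i)).
have dTm n m i t : 0 < m -> 0 <= t -> ex_derive_half (Derive_half_n n (Theta m i)) t.
  by move=> m0 t0; eexists; exact: (is_derive_half_Derive_half_n t0 (Sq m m0 n.+1 i)).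
have expk t b : t <= b -> exp (2 * kappa * t) <= exp (2 * kappa * b).
  by move=> tb; apply: exp_le_mono; apply: Rmult_le_compat_l; lra.
have cvg0 (I : R -> Prop) : (forall s, I s -> 0 <= s) -> cvg_C0 I Theta (Theta 0).
  move=> I0; apply: cvg_C0_linear.
  - by move=> m i m0; apply: continuous_on_half => // s Is; apply: (dTm 0%N) => //; exact: I0.
  - by move=> i; apply: continuous_on_half => // s Is; apply: (dT 0%N); exact: I0.
  - move=> a b ab Ia.
    exists (Rabs ((vmax slip + vmin slip) / 2) + 1 / 2 * (diam slip + 2 * kappa) * exp (2 * kappa * b)).
    move=> m t [m0 _] [at_ tb]; have t0 : 0 <= t by have := I0 a Ia; lra.
    apply: Rlt_le; apply: Rlt_le_trans (proj1 (bound0 m t m0 t0)) _.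
    have mK : 0 <= m * (diam slip + 2 * kappa) by nonneg.
    by have := Rmult_le_compat_l _ _ _ mK (expk t b tb); lra.
have cvgn n : cvg_C0 (Rlt 0) (fun m i => Derive_half_n n (Theta m i)) (fun i => Derive_half_n n (Theta 0 i)).
  case: n => [|n]; first by apply: cvg0 => s; exact: Rlt_le.
  apply: cvg_C0_linear.
  - move=> m i m0; apply: continuous_on_half => s s0; [exact: Rlt_le | apply: dTm => //; exact: Rlt_le].
  - move=> i; apply: continuous_on_half => s s0; [exact: Rlt_le | apply: dT; exact: Rlt_le].
  move=> a b ab a0.
  have eb := exp_pos (2 * kappa * b).
  case: n => [|n].
    (* With exponent 0 only the exponential remains, giving [exp (- t / m) <= M * m]. *)
    have [M [M0 HM]] := initial_layer_le 0%N (conj a0 ab) (Rle_refl 0).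
    exists ((norm_inf slip + kappa) * M + (kappa * (diam nu + 2 * kappa)
        + kappa * (diam slip + 2 * kappa) * exp (2 * kappa * b))).
    move=> m t [m0 m1] [at_ tb]; have t0 : 0 <= t by lra.
    apply: Rlt_le; apply: Rlt_le_trans (proj1 (bound1 m t m0 t0)) _.
    have := HM m t (conj m0 m1) (conj at_ tb); rewrite /= !Rmult_1_l => H1.
    have k0 : 0 <= norm_inf slip + kappa by lra.
    have := Rmult_le_compat_l _ _ _ k0 H1.
    have mK : 0 <= m * kappa * (diam slip + 2 * kappa) by nonneg.
    by have := Rmult_le_compat_l _ _ _ mK (expk t b tb); lra.
  pose c1 := 2 * kappa + norm_inf omega0 + norm_inf nu; pose c2 := 2 * kappa + diam omega0 + diam nu.
  have [M1 [M10 HM1]] := initial_layer_le (c := c1) n.+2 (conj a0 ab) ltac:(rewrite /c1; lra).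
  have [M2 [M20 HM2]] := initial_layer_le (c := c2) n.+2 (conj a0 ab) ltac:(rewrite /c2; lra).
  exists (INR (n.+1)`! * M1 + 9 / 8 * kappa * INR (n.+2)`! * exp (2 * kappa * b) * M2
     + 3 / 4 * kappa * INR (n.+3)`! * exp (2 * kappa * b) * c2 ^ n.+2).
  move=> m t [m0 m1] [at_ tb]; have t0 : 0 <= t by lra.
  apply: Rle_trans (proj1 (boundn m n.+2 t m0 isT t0)) _.
  have H1 := HM1 m t (conj m0 m1) (conj at_ tb); have H2 := HM2 m t (conj m0 m1) (conj at_ tb).
  have Et := expk t b tb; have et := exp_pos (2 * kappa * t); have e0 := decay m t.
  rewrite -/c1 -/c2 -[(n.+2).-1]/(n.+1).
  have c20 : 0 <= c2 by rewrite /c2; lra.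
  have tm := Rdiv_le_0_compat _ _ t0 m0.
  have ic : 0 < 9 / (8 * m) by apply: Rdiv_lt_0_compat; lra.
  set X1 := (c1 + _) ^ _ in H1 *; set X2 := (c2 + _) ^ _ in H2 *.
  have X20 : 0 <= X2 by apply: pow_le; lra.
  set L := (1 + t / m) ^ _ in H1 H2 *; have L0 : 0 <= L by apply: pow_le; lra.
  set e := exp (- t / m) in e0 H1 H2 *; set f1 := INR _; set f2 := INR _; set f3 := INR _.
  have [f10 [f20 f30]] : 0 <= f1 /\ 0 <= f2 /\ 0 <= f3 by split; [|split]; exact: pos_INR.
  set E := exp _ in Et et *; set Eb := exp _ in Et eb *; set C2 := c2 ^ _.
  have C20 : 0 <= C2 by exact: pow_le.
  have K1 := Rmult_le_compat_l _ _ _ f10 H1.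
  (* The layer factor already supplies the power of [m], so the explicit [m] is bounded by 1. *)
  have K2 : (9 / 8 * m * kappa * f2 * E) * (X2 * L * e) <= (9 / 8 * 1 * kappa * f2 * Eb) * (M2 * m).
    apply: Rmult_le_compat => //; try by nonneg.
    by apply: Rmult_le_compat => //; nonneg; repeat apply: Rmult_le_compat_r; lra.
  have K3 : 3 / 4 * m * kappa * f3 * E * C2 * (1 - e) <= 3 / 4 * m * kappa * f3 * Eb * C2 * 1.
    apply: Rmult_le_compat.
    - by nonneg.
    - have := proj2 (exp_decay m0 t0); rewrite -/e; lra.
    - apply: Rmult_le_compat_r => //; apply: Rmult_le_compat_l => //; nonneg.
    - lra.
  lra.
split; first exact: cvg0.
split; first exact: (cvgn 1%N).
split; last split.
- by move=> n m i t m0 t0; apply: dTm => //; exact: Rlt_le.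
- by move=> n i t t0; apply: dT; exact: Rlt_le.
- exact: cvgn.
Qed.
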